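(* Let $\varphi$ be a polynomial with real coefficients of degree greater than one. Then $C_\varphi:\mathcal{S}(\mathbb{R})\to\mathcal{S}(\mathbb{R})$ is mean ergodic if and only if $\sigma(C_\varphi)=\{0\}$.
   Context: $\mathcal{S}(\mathbb{R})$ is the Fréchet space of (complex-valued) smooth rapidly decreasing functions on $\mathbb{R}$ (Schwartz space). For a non-constant real polynomial $\varphi$, the composition operator $C_\varphi:\mathcal{S}(\mathbb{R})\to\mathcal{S}(\mathbb{R})$, $C_\varphi f=f\circ\varphi$, is well defined, linear and continuous. For a continuous linear operator $T:X\to X$ on a Fréchet space $X$: the spectrum $\sigma(T)$ is the set of all $\lambda\in\mathbb{C}$ such that $T-\lambda I:X\to X$ does not admit a continuous linear inverse; the Cesàro means of $T$ are $T_{[n]}=\frac1n\sum_{k=1}^{n}T^k$; and $T$ is mean ergodic if there is a continuous linear operator $P$ on $X$ such that $T_{[n]}(x)\to P(x)$ in $X$ for every $x\in X$. *)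

(* Defs.v *)
From HB Require Import structures.
From mathcomp Require Import all_boot all_order all_algebra.
From mathcomp Require Import complex.
From mathcomp Require Import all_classical all_reals all_analysis.
From mathcomp Require Import ring lra.

Set Implicit Arguments.
Unset Strict Implicit.
Unset Printing Implicit Defensive.

Import Order.TTheory GRing.Theory Num.Theory.
Import numFieldNormedType.Exports.

Local Open Scope classical_set_scope.
Local Open Scope ring_scope.
Local Open Scope complex_scope.

(* [Rcomplex R] is [R[i]] seen as a real vector space, with its modulus valued
   in [R]; its normed-space structure is what gives a meaning to the derivatives
   of functions from [R] to the complex numbers. *)
Section Rcomplex_normedModType.
Variable R : realType.

HB.instance Definition _ :=
  PseudoMetric.copy (Rcomplex R) (pseudoMetric_normed (Rcomplex R)).
HB.instance Definition _ := isPointed.Build (Rcomplex R) 0.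
HB.instance Definition _ :=
  NormedZmod_PseudoMetric_eq.Build R (Rcomplex R) erefl.

Lemma Rcomplex_normZ (l : R) (x : Rcomplex R) : `| l *: x | = `| l | * `| x |.
Proof.
case: x => a b; rewrite /Num.norm /= !exprMn -mulrDr sqrtrM ?sqr_ge0//.
by rewrite sqrtr_sqr.
Qed.

HB.instance Definition _ :=
  PseudoMetricNormedZmod_Lmodule_isNormedModule.Build R (Rcomplex R)
    Rcomplex_normZ.

Lemma Rcomplex_normM (c z : Rcomplex R) :
  `|c * z : Rcomplex R| = `|c| * `|z|.
Proof. exact: Normc.normcM. Qed.

Lemma Rcomplex_Re_le (z : Rcomplex R) : `|complex.Re z| <= `|z|.
Proof.
case: z => a b /=; rewrite -sqrtr_sqr [leRHS]/Num.norm /=.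
by rewrite ler_wsqrtr // lerDl sqr_ge0.
Qed.

Lemma Rcomplex_Im_le (z : Rcomplex R) : `|complex.Im z| <= `|z|.
Proof.
case: z => a b /=; rewrite -sqrtr_sqr [leRHS]/Num.norm /=.
by rewrite ler_wsqrtr // lerDr sqr_ge0.
Qed.

End Rcomplex_normedModType.

Section derivatives.
Variable R : realType.

Lemma is_derive_bounded_linear (V W : normedModType R) (L : {linear V -> W})
    (K : R) (LK : forall z, `|L z| <= K * `|z|) (f : R -> V) (x : R) (df : V) :
  is_derive x 1 f df -> is_derive x 1 (fun y => L (f y)) (L df).
Proof.
move=> [fx dfE].
have Lc : continuous L.
  move=> z; apply/cvgrPdist_lt => e e0.
  have K0 : 0 < `|K| + 1 by rewrite ltr_pwDr.
  near=> w; rewrite -linearB (le_lt_trans (LK _))//.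
  rewrite (@le_lt_trans _ _ ((`|K| + 1) * `|z - w|))//.
    by rewrite ler_wpM2r// (le_trans (ler_norm K))// lerDl.
  rewrite -ltr_pdivlMl//; near: w; apply: cvgr_dist_lt => //.
  by rewrite mulr_gt0// invr_gt0.
pose q (h : R) := h^-1 *: ((f \o shift x) (h *: 1) - f x).
pose Lq (h : R) :=
  h^-1 *: (((fun y => L (f y)) \o shift x) (h *: 1) - L (f x)).
have LqE : Lq = L \o q.
  by apply/funext => h; rewrite /Lq /q /= -(linearB L) linearZ_LR.
have H : Lq @ 0^' --> L df.
  rewrite LqE; apply: (@cvg_comp _ _ _ q L _ (nbhs df)); last exact: Lc.
  by rewrite -dfE; exact: fx.
split; first by apply/cvg_ex; exists (L df).
exact: cvg_lim H.
Unshelve. all: by end_near. Qed.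

Lemma is_derive_cmul (c : R[i]) (f : R -> Rcomplex R) (x : R)
    (df : Rcomplex R) : is_derive x 1 f df ->
  is_derive x 1 (fun y => c * f y : Rcomplex R) (c * df : Rcomplex R).
Proof.
pose L (z : Rcomplex R) : Rcomplex R := c * z.
have Ll : linear L.
  move=> a u v; rewrite /L mulrDr; congr (_ + _).
  by case: (c) u => c1 c2 [u1 u2]; congr (_ +i* _) => /=; ring.
pose L' : {linear Rcomplex R -> Rcomplex R} :=
  HB.pack L (GRing.isLinear.Build _ _ _ _ _ Ll).
apply: (@is_derive_bounded_linear _ _ L' `|c : Rcomplex R|) => z.
by rewrite -Rcomplex_normM.
Qed.

Lemma is_derive_ReIm (f : R -> Rcomplex R) (x : R) (df : Rcomplex R) :
  is_derive x 1 f df <->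
  is_derive x 1 (fun y => complex.Re (f y)) (complex.Re df) /\
  is_derive x 1 (fun y => complex.Im (f y)) (complex.Im df).
Proof.
split=> [fdf|[fr fi]].
  split.
    apply: (@is_derive_bounded_linear (Rcomplex R) R
      (@complex.Re R : {linear Rcomplex R -> R}) 1) => // z.
    by rewrite mul1r Rcomplex_Re_le.
  apply: (@is_derive_bounded_linear (Rcomplex R) R
    (@complex.Im R : {linear Rcomplex R -> R}) 1) => // z.
  by rewrite mul1r Rcomplex_Im_le.
pose L (w : Rcomplex R) (r : R) : Rcomplex R := r *: w.
have Ll w : linear (L w) by move=> a u v; rewrite /L scalerDl scalerA.
pose L' w : {linear R -> Rcomplex R} :=
  HB.pack (L w) (GRing.isLinear.Build _ _ _ _ _ (Ll w)).
have Lb w r : `|L' w r| <= `|w| * `|r| by rewrite normrZ mulrC.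
have := is_deriveD
  (is_derive_bounded_linear (Lb (1 : Rcomplex R)) fr)
  (is_derive_bounded_linear (Lb ('i%C : Rcomplex R)) fi).
have E (z : Rcomplex R) :
    L' (1 : Rcomplex R) (complex.Re z) + L' ('i%C : Rcomplex R) (complex.Im z) = z.
  by case: z => a b; congr (_ +i* _) => /=; ring.
rewrite E; suff <- : f = (fun y => L' (1 : Rcomplex R) (complex.Re (f y))) +
  (fun y => L' ('i%C : Rcomplex R) (complex.Im (f y))) by [].
by apply/funext => y; rewrite -[LHS]E.
Qed.

Lemma is_derive_poly_comp (h phi : {poly R}) (f : R -> Rcomplex R) (x : R)
    (df : Rcomplex R) : is_derive phi.[x] 1 f df ->
  is_derive x 1 (fun y => h.[y] *: f phi.[y])
    ((h^`()).[x] *: f phi.[x] + (h * phi^`()).[x] *: df).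
Proof.
move=> /is_derive_ReIm[fr fi]; apply/is_derive_ReIm.
have H (g : R -> R) dg : is_derive phi.[x] 1 g dg ->
  is_derive x 1 (fun y => h.[y] * g phi.[y])
   ((h^`()).[x] * g phi.[x] + (h * phi^`()).[x] * dg).
  move=> gdg.
  have gp : is_derive x 1 (fun y => g phi.[y]) (phi^`().[x] * dg).
    have := @is_derive1_comp R g (horner phi) x dg phi^`().[x] gdg _.
    by rewrite mulrC; exact.
  have hp := is_derive_poly h x.
  apply: is_derive_eq (is_deriveM hp gp) _.
  by rewrite hornerM /GRing.scale /=; ring.
have ReE (a : R) (z : Rcomplex R) : complex.Re (a *: z) = a * complex.Re z.
  by case: z.
have ImE (a : R) (z : Rcomplex R) : complex.Im (a *: z) = a * complex.Im z.
  by case: z.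
split.
  have -> : (fun y => complex.Re (h.[y] *: f phi.[y])) =
            (fun y => h.[y] * complex.Re (f phi.[y])) by apply/funext => y.
  by rewrite raddfD /= !ReE; exact: H fr.
have -> : (fun y => complex.Im (h.[y] *: f phi.[y])) =
          (fun y => h.[y] * complex.Im (f phi.[y])) by apply/funext => y.
by rewrite raddfD /= !ImE; exact: H fi.
Qed.

End derivatives.

Section schwartz_functions.
Variable R : realType.
Implicit Types f g : R -> Rcomplex R.

Definition smooth f := forall n (x : R), derivable (derive1n n f) x 1.

Definition rapidly_decreasing f := forall i j : nat, exists M : R,
  forall x, `|x| ^+ i * `|derive1n j f x| <= M.

Definition is_schwartz f := smooth f /\ rapidly_decreasing f.

Lemma derive1_fun f (df : R -> Rcomplex R) :
  (forall x : R, is_derive x 1 f (df x)) -> derive1 f = df.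
Proof. by move=> H; apply/funext => x; rewrite derive1E derive_val. Qed.

Lemma is_derive_derive1 f (x : R) : derivable f x 1 -> is_derive x 1 f (derive1 f x).
Proof. by move=> fx; rewrite derive1E; exact: derivableP. Qed.

Lemma is_schwartz_coind (P : (R -> Rcomplex R) -> Prop) :
    (forall f, P f -> exists2 df, P df & forall x : R, is_derive x 1 f (df x)) ->
    (forall f, P f -> forall i, exists M, forall x, `|x| ^+ i * `|f x| <= M) ->
  forall f, P f -> is_schwartz f.
Proof.
move=> Pd Pb f Pf.
have Pn n : P (derive1n n f).
  elim: n => [//|n /Pd [df Pdf H]].
  by rewrite derive1nS (derive1_fun H).
split; first by move=> n x; have [df _ /(_ x) []] := Pd _ (Pn n).
by move=> i j; exact: Pb.
Qed.

Lemma is_schwartz_derivable f (x : R) : is_schwartz f -> derivable f x 1.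
Proof. by case=> /(_ 0%N x). Qed.

Lemma is_schwartz_bounded f i : is_schwartz f ->
  exists M, forall x, `|x| ^+ i * `|f x| <= M.
Proof. by case=> _ /(_ i 0%N). Qed.

Lemma is_schwartz_derive1 f : is_schwartz f -> is_schwartz (derive1 f).
Proof.
move=> [fs fd]; split => [n x|i j].
  by rewrite -derive1Sn; exact: fs.
by have [M HM] := fd i j.+1; exists M => x; rewrite -derive1Sn.
Qed.

Lemma is_schwartz0 : is_schwartz (fun=> 0).
Proof.
apply: (@is_schwartz_coind (fun f => f = fun=> 0)) => // f -> .
  by exists (fun=> 0) => // x; exact: is_derive_cst.
by move=> i; exists 0 => x; rewrite normr0 mulr0.
Qed.

Lemma is_schwartzD f g : is_schwartz f -> is_schwartz g ->
  is_schwartz (fun x => f x + g x).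
Proof.
move=> fS gS; pose P h := exists f1 g1, [/\ is_schwartz f1, is_schwartz g1 &
  h = (fun x => f1 x + g1 x)].
apply: (@is_schwartz_coind P); last by exists f, g.
- move=> _ [f1 [g1 [f1S g1S ->]]]; exists (fun x => derive1 f1 x + derive1 g1 x).
    exists (derive1 f1), (derive1 g1).
    by split => //; exact: is_schwartz_derive1.
  move=> x; have d1 := is_derive_derive1 (@is_schwartz_derivable _ x f1S).
  have d2 := is_derive_derive1 (@is_schwartz_derivable _ x g1S).
  exact: is_deriveD.
- move=> _ [f1 [g1 [f1S g1S ->]]] i.
  have [M HM] := is_schwartz_bounded i f1S.
  have [N HN] := is_schwartz_bounded i g1S.
  exists (M + N) => x; rewrite (le_trans _ (lerD (HM x) (HN x)))// -mulrDr.
  by rewrite ler_wpM2l ?exprn_ge0// ler_normD.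
Qed.

Lemma is_schwartzM (c : R[i]) f : is_schwartz f ->
  is_schwartz (fun x => c * f x).
Proof.
move=> fS; pose P h := exists2 f1, is_schwartz f1 & h = (fun x => c * f1 x).
apply: (@is_schwartz_coind P); last by exists f.
- move=> _ [f1 f1S ->]; exists (fun x => c * derive1 f1 x).
    by exists (derive1 f1) => //; exact: is_schwartz_derive1.
  move=> x; apply: is_derive_cmul; apply: is_derive_derive1.
  exact: is_schwartz_derivable.
- move=> _ [f1 f1S ->] i; have [M HM] := is_schwartz_bounded i f1S.
  exists (`|c : Rcomplex R| * M) => x; rewrite Rcomplex_normM mulrCA.
  by rewrite ler_wpM2l.
Qed.

Lemma poly_growth (h : {poly R}) : exists (B : R) (m : nat),
  0 <= B /\ forall x, `|h.[x]| <= B * (1 + `|x|) ^+ m.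
Proof.
elim/poly_ind: h => [|h c [B [m [B0 HB]]]].
  by exists 0, 0%N; split => // x; rewrite horner0 normr0 mul0r.
exists (B + `|c|), m.+1; split; first by rewrite addr_ge0.
move=> x; rewrite hornerMXaddC (le_trans (ler_normD _ _))// normrM mulrDl.
have x1 : 1 <= 1 + `|x| by rewrite lerDl.
apply: lerD.
  rewrite exprSr mulrA; apply: ler_pM => //.
  by rewrite lerDr.
by rewrite ler_peMr// exprn_ege1.
Qed.

Lemma poly_coercive (phi : {poly R}) : (1 < size phi)%N ->
  exists2 A : R, 0 <= A & forall x, `|x| <= A * (1 + `|phi.[x]|).
Proof.
elim/poly_ind: phi => [|q c IH]; first by rewrite size_poly0.
have [|q1 _] := leqP (size q) 1.
  move=> /size1_polyC ->; set a := q`_0.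
  have [->|a0] := eqVneq a 0.
    by rewrite mul0r add0r ltnNge size_polyC_leq1.
  move=> _; exists (`|a|^-1 * (1 + `|c|)) => [|x].
    by rewrite mulr_ge0 ?addr_ge0.
  rewrite hornerMXaddC hornerC -mulrA ler_pdivlMl ?normr_gt0// -normrM.
  have := ler_normB (a * x + c) c; rewrite addrK => /le_trans; apply.
  rewrite mulrDr mulr1 mulrDl mul1r.
  by have := normr_ge0 c; have := normr_ge0 (a * x + c); nra.
have [A A0 HA] := IH q1.
exists (1 + `|c| + 2 * A) => [|x]; first by rewrite !addr_ge0// mulr_ge0.
rewrite hornerMXaddC.
have := ler_normB (q.[x] * x + c) c; rewrite addrK normrM.
have := HA x.
set X := `|x|; set Q := `|q.[x]|; set F := `|_ + c|; set C := `|c|.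
have [X0 Q0 F0 C0] : [/\ 0 <= X, 0 <= Q, 0 <= F & 0 <= C].
  by split; exact: normr_ge0.
move=> h1 h2.
have [h3|h3] := leP X (2 * A).
  have : 0 <= (1 + C + 2 * A) * F by rewrite mulr_ge0// !addr_ge0// mulr_ge0.
  lra.
have Q1 : 1 <= Q by nra.
have : X <= F + C by apply: le_trans h2; rewrite ler_peMl.
nra.
Qed.

Lemma is_schwartz_comp_bounded (h phi : {poly R}) f i : (1 < size phi)%N ->
  is_schwartz f -> exists M, forall x, `|x| ^+ i * `|h.[x] *: f phi.[x]| <= M.
Proof.
move=> phi1 fS.
have [B [m [B0 HB]]] := poly_growth h.
have [A A0 HA] := poly_coercive phi1.
have bnd k : forall l, exists M, forall y, (1 + `|y|) ^+ k * (`|y| ^+ l * `|f y|) <= M.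
  elim: k => [|k IH] l.
    have [M HM] := is_schwartz_bounded l fS.
    by exists M => y; rewrite expr0 mul1r.
  have [M1 HM1] := IH l; have [M2 HM2] := IH l.+1.
  exists (M1 + M2) => y; have := HM1 y; have := HM2 y; rewrite !exprS; nra.
have [M HM] := bnd (m + i)%N 0%N.
exists (B * (1 + A) ^+ (m + i) * M) => x.
rewrite Rcomplex_normZ mulrA.
have x1 : 0 <= 1 + `|x| by rewrite addr_ge0.
have step1 : `|x| ^+ i * `|h.[x]| <= B * (1 + `|x|) ^+ (m + i).
  rewrite exprD mulrA mulrC ler_pM// ?exprn_ge0// lerXn2r ?nnegrE// lerDr//.
have step2 : (1 + `|x|) ^+ (m + i) <= (1 + A) ^+ (m + i) * (1 + `|phi.[x]|) ^+ (m + i).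
  rewrite -exprMn lerXn2r ?nnegrE ?mulr_ge0 ?addr_ge0//.
  by have := HA x; have := normr_ge0 phi.[x]; nra.
apply: (@le_trans _ _ (B * ((1 + A) ^+ (m + i) * (1 + `|phi.[x]|) ^+ (m + i))
    * `|f phi.[x]|)).
  rewrite ler_wpM2r// (le_trans step1)// ler_wpM2l//.
rewrite -!mulrA ler_wpM2l// ler_wpM2l ?exprn_ge0 ?addr_ge0//.
by have := HM phi.[x]; rewrite expr0 mul1r.
Qed.

Lemma is_schwartz_comp (phi : {poly R}) f : (1 < size phi)%N ->
  is_schwartz f -> is_schwartz (fun x => f phi.[x]).
Proof.
move=> phi1 fS.
pose P := fix P n (g : R -> Rcomplex R) := if n is n'.+1 then
  exists h g1 g2, [/\ is_schwartz g1, P n' g2 &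
    g = (fun x => (h : {poly R}).[x] *: g1 phi.[x] + g2 x)] else g = fun=> 0.
have PD n m g1 g2 : P n g1 -> P m g2 -> P (n + m)%N (fun x => g1 x + g2 x).
  elim: n g1 => [|n IH] g1 /=.
    by move=> -> Pg2; rewrite (_ : (fun _ => _) = g2)//; apply/funext => x; rewrite add0r.
  move=> [h [k1 [k2 [k1S Pk2 ->]]]] Pg2; exists h, k1, (fun x => k2 x + g2 x).
  split => //; first exact: IH.
  by apply/funext => x; rewrite addrA.
have P1 h g : is_schwartz g -> P 1%N (fun x => h.[x] *: g phi.[x]).
  move=> gS; exists h, g, (fun=> 0); split => //.
  by apply/funext => x; rewrite addr0.
apply: (@is_schwartz_coind (fun g => exists n, P n g)).
- move=> g [n]; elim: n g => [|n IH] g /=.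
    move=> ->; exists (fun=> 0); first by exists 0%N.
    by move=> x; exact: is_derive_cst.
  move=> [h [g1 [g2 [g1S Pg2 ->]]]].
  have [dg2 [m Pdg2] dg2E] := IH _ Pg2.
  exists (fun x => (h^`()).[x] *: g1 phi.[x]
    + (h * phi^`()).[x] *: derive1 g1 phi.[x] + dg2 x).
    exists (1 + 1 + m)%N; apply: (@PD 2%N) => //; apply: (@PD 1%N 1%N); apply: P1 => //.
    exact: is_schwartz_derive1.
  move=> x.
  have d1 := is_derive_derive1 (@is_schwartz_derivable _ phi.[x] g1S).
  exact: is_deriveD (is_derive_poly_comp h d1) (dg2E x).
- move=> g [n]; elim: n g => [|n IH] g /=.
    by move=> -> i; exists 0 => x; rewrite normr0 mulr0.
  move=> [h [g1 [g2 [g1S Pg2 ->]]]] i.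
  have [M HM] := is_schwartz_comp_bounded h i phi1 g1S.
  have [N HN] := IH _ Pg2 i.
  exists (M + N) => x; rewrite (le_trans _ (lerD (HM x) (HN x)))// -mulrDr.
  by rewrite ler_wpM2l ?exprn_ge0// ler_normD.
- exists 1%N; have := P1 1 f fS; congr P; apply/funext => x.
  by rewrite hornerC scale1r.
Qed.

End schwartz_functions.

Section schwartz_space.
Variable R : realType.

Definition schwartz_pred : {pred R -> R[i]} := fun f => `[< is_schwartz f >].

Structure schwartz := Schwartz {
  schwartz_fun :> R -> R[i];
  _ : schwartz_fun \in schwartz_pred }.

HB.instance Definition _ := [isSub for schwartz_fun].
HB.instance Definition _ := [Choice of schwartz by <:].

Lemma schwartz_submod_closed : submod_closed schwartz_pred.
Proof.
split; first by apply/asboolP; exact: is_schwartz0.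
move=> c f g /asboolP fS /asboolP gS; apply/asboolP.
exact: is_schwartzD (is_schwartzM c fS) gS.
Qed.

HB.instance Definition _ :=
  GRing.isSubmodClosed.Build R[i] (R -> R[i]) schwartz_pred
    schwartz_submod_closed.
HB.instance Definition _ := [SubChoice_isSubLmodule of schwartz by <:].

Lemma schwartzP (f : schwartz) : is_schwartz f.
Proof. by apply/asboolP; case: f. Qed.

Lemma schwartz_ext (f g : schwartz) : (forall x, f x = g x) -> f = g.
Proof. by move=> fg; apply: val_inj; exact/funext. Qed.

Lemma schwartzDE (f g : schwartz) x : (f + g) x = f x + g x.
Proof. by []. Qed.

Lemma schwartzZE (c : R[i]) (f : schwartz) x : (c *: f) x = c * f x.
Proof. by []. Qed.

Implicit Types f g : schwartz.

(* The increasing sequence of norms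
   sup { |x|^i |f^(j)(x)| : x real, i, j <= N }, N = 0, 1, 2, ... *)
Definition schwartz_norm_set (N : nat) (f : schwartz) : set R :=
  [set r | exists i j x, [/\ (i <= N)%N, (j <= N)%N &
     r = `|x| ^+ i * `|derive1n j (f : R -> Rcomplex R) x|]].

Definition schwartz_norm (N : nat) (f : schwartz) : R :=
  sup (schwartz_norm_set N f).

Lemma schwartz_norm_has_sup N f : has_sup (schwartz_norm_set N f).
Proof.
split.
  by exists (`|0 : R| ^+ 0 * `|derive1n 0 (f : R -> Rcomplex R) 0|), 0%N, 0%N, 0.
have [_ /(_ _ _)/cid fd] := schwartzP f.
pose M i j := sval (fd i j).
exists (\sum_(i < N.+1) \sum_(j < N.+1) `|M i j|) => _ [i [j [x [iN jN ->]]]].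
apply: (@le_trans _ _ `|M i j|).
  by rewrite (le_trans (svalP (fd i j) x))// ler_norm.
rewrite (bigD1 (Ordinal (iN : (i < N.+1)%N)))//=.
rewrite (bigD1 (Ordinal (jN : (j < N.+1)%N)))//= -addrA lerDl addr_ge0//.
  by rewrite sumr_ge0.
by rewrite sumr_ge0// => ? _; rewrite sumr_ge0.
Qed.

Lemma schwartz_norm_ub N f i j x : (i <= N)%N -> (j <= N)%N ->
  `|x| ^+ i * `|derive1n j (f : R -> Rcomplex R) x| <= schwartz_norm N f.
Proof.
move=> iN jN; have [_ ub] := schwartz_norm_has_sup N f.
by apply: ub_le_sup => //; exists i, j, x.
Qed.

Lemma schwartz_norm_le N f (M : R) :
  (forall i j x, (i <= N)%N -> (j <= N)%N ->
     `|x| ^+ i * `|derive1n j (f : R -> Rcomplex R) x| <= M) ->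
  schwartz_norm N f <= M.
Proof.
move=> H; have [ne _] := schwartz_norm_has_sup N f.
by apply: ge_sup => // _ [i [j [x [iN jN ->]]]]; exact: H.
Qed.

Lemma schwartz_norm_ge0 N f : 0 <= schwartz_norm N f.
Proof.
have := @schwartz_norm_ub N f 0%N 0%N 0 (leq0n N) (leq0n N); apply: le_trans.
by rewrite mulr_ge0// exprn_ge0.
Qed.

Lemma schwartz_norm_mono N N' f : (N <= N')%N ->
  schwartz_norm N f <= schwartz_norm N' f.
Proof.
move=> NN'; apply: schwartz_norm_le => i j x iN jN.
by apply: schwartz_norm_ub; exact: leq_trans NN'.
Qed.

Lemma derive1n_schwartzD n (f g : schwartz) :
  derive1n n (f + g : R -> Rcomplex R) =
  (fun x => derive1n n (f : R -> Rcomplex R) x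
          + derive1n n (g : R -> Rcomplex R) x).
Proof.
elim: n => [//|n IH]; rewrite derive1nS IH; apply: derive1_fun => x.
have [fs _] := schwartzP f; have [gs _] := schwartzP g.
exact: is_deriveD (is_derive_derive1 (fs n x)) (is_derive_derive1 (gs n x)).
Qed.

Lemma derive1n_schwartzZ n (c : R[i]) (f : schwartz) :
  derive1n n (c *: f : R -> Rcomplex R) =
  (fun x => c * derive1n n (f : R -> Rcomplex R) x).
Proof.
elim: n => [//|n IH]; rewrite derive1nS IH; apply: derive1_fun => x.
have [fs _] := schwartzP f.
exact: is_derive_cmul (is_derive_derive1 (fs n x)).
Qed.

Lemma schwartz_normD N f g :
  schwartz_norm N (f + g) <= schwartz_norm N f + schwartz_norm N g.
Proof.
apply: schwartz_norm_le => i j x iN jN; rewrite derive1n_schwartzD.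
apply: le_trans (lerD (schwartz_norm_ub f x iN jN)
                      (schwartz_norm_ub g x iN jN)).
by rewrite -mulrDr ler_wpM2l ?exprn_ge0// ler_normD.
Qed.

Lemma schwartz_normZ N (c : R[i]) f :
  schwartz_norm N (c *: f) <= `|c : Rcomplex R| * schwartz_norm N f.
Proof.
apply: schwartz_norm_le => i j x iN jN; rewrite derive1n_schwartzZ.
by rewrite Rcomplex_normM mulrCA ler_wpM2l// schwartz_norm_ub.
Qed.

Lemma schwartz_norm0 N : schwartz_norm N 0 = 0.
Proof.
apply/eqP; rewrite eq_le schwartz_norm_ge0 andbT.
have := schwartz_normZ N 0 0; rewrite scale0r => /le_trans; apply.
by rewrite normr0 mul0r.
Qed.

Lemma schwartz_normN N f : schwartz_norm N (- f) = schwartz_norm N f.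
Proof.
have H g : schwartz_norm N (- g) <= schwartz_norm N g.
  rewrite -scaleN1r (le_trans (schwartz_normZ _ _ _))//.
  by rewrite normrN /Num.norm /= expr1n expr0n addr0 sqrtr1 mul1r.
by apply/eqP; rewrite eq_le H /= -{1}(opprK f) H.
Qed.

Definition schwartz_entourage : set_system (schwartz * schwartz) :=
  [set A | exists N, exists2 e : R, 0 < e &
     [set fg | schwartz_norm N (fg.1 - fg.2) < e] `<=` A].

Lemma schwartz_entourage_filter : Filter schwartz_entourage.
Proof.
split.
- by exists 0%N, 1.
- move=> A B [N [e e0 HA]] [M [d d0 HB]].
  exists (maxn N M), (Num.min e d); first by rewrite lt_min e0.
  move=> fg /=; rewrite lt_min => /andP[fge fgd]; split.
    by apply: HA => /=; apply: le_lt_trans fge; apply: schwartz_norm_mono; rewrite leq_maxl.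
  by apply: HB => /=; apply: le_lt_trans fgd; apply: schwartz_norm_mono; rewrite leq_maxr.
- by move=> A B AB [N [e e0 HA]]; exists N, e => //; exact: subset_trans AB.
Qed.

Lemma schwartz_entourage_refl A :
  schwartz_entourage A -> diagonal `<=` A.
Proof.
move=> [N [e e0 HA]] [f g] /diagonalP /= ->; apply: HA => /=.
by rewrite subrr schwartz_norm0.
Qed.

Lemma schwartz_entourage_inv A :
  schwartz_entourage A -> schwartz_entourage (A^-1)%relation.
Proof.
move=> [N [e e0 HA]]; exists N, e => // -[f g] /= fg; apply: HA => /=.
by rewrite -opprB schwartz_normN.
Qed.

Lemma schwartz_entourage_split A : schwartz_entourage A ->
  exists2 B, schwartz_entourage B & (B \; B)%relation `<=` A.
Proof.
move=> [N [e e0 HA]].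
exists [set fg | schwartz_norm N (fg.1 - fg.2) < e / 2].
  by exists N, (e / 2) => //; rewrite divr_gt0.
move=> [f g] [h /= fh hg]; apply: HA => /=.
rewrite -(subrK h f) -addrA (le_lt_trans (schwartz_normD _ _ _))//.
by rewrite [e]splitr ltrD.
Qed.

HB.instance Definition _ := isUniform.Build schwartz
  schwartz_entourage_filter schwartz_entourage_refl schwartz_entourage_inv
  schwartz_entourage_split.

Lemma nbhs_schwartzP (f : schwartz) (A : set schwartz) : nbhs f A <->
  exists N, exists2 e : R, 0 < e & forall g, schwartz_norm N (f - g) < e -> A g.
Proof.
split=> [[B [N [e e0 HB]] BA]|[N [e e0 HA]]].
  by exists N, e => // g fg; apply: BA; apply/mem_set; exact: HB.
exists [set fg | schwartz_norm N (fg.1 - fg.2) < e]; first by exists N, e.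
by move=> g /set_mem; exact: HA.
Qed.

Lemma schwartz_add_continuous :
  continuous (fun fg : schwartz * schwartz => fg.1 + fg.2).
Proof.
move=> [f g] A /nbhs_schwartzP[N [e e0 HA]].
pose B h := [set k | schwartz_norm N (h - k) < e / 2].
have nB h : nbhs h (B h).
  by apply/nbhs_schwartzP; exists N, (e / 2) => //; rewrite divr_gt0.
exists (B f, B g); first by split; exact: nB.
move=> [f1 g1] [/= ff gg]; apply: HA.
rewrite opprD addrACA (le_lt_trans (schwartz_normD _ _ _))//.
by rewrite [e]splitr ltrD.
Qed.

Lemma schwartz_scale_continuous :
  continuous (fun cf : R[i]^o * schwartz => cf.1 *: cf.2).
Proof.
move=> [c f] A /nbhs_schwartzP[N [e e0 HA]].
pose M := schwartz_norm N f + `|c : Rcomplex R| + 1.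
have M1 : 1 <= M by rewrite lerDr addr_ge0// schwartz_norm_ge0.
have M0 : 0 < M by exact: lt_le_trans M1.
pose d := Num.min 1 (e / 2 / M).
have d0 : 0 < d by rewrite lt_min ltr01 !divr_gt0.
exists (ball c d%:C, [set g | schwartz_norm N (f - g) < d]).
  split => /=.
    by apply: nbhsx_ballx; rewrite ltcR.
  by apply/nbhs_schwartzP; exists N, d.
move=> [b g] [/= cb fg]; apply: HA.
have {}cb : `|(c - b : Rcomplex R)| < d.
  by move: cb; rewrite -ball_normE /= ltcR.
have {}fg : schwartz_norm N (f - g) < d by exact: fg.
have -> : c *: f - b *: g = (c - b) *: f + b *: (f - g).
  by rewrite scalerBl scalerBr addrA subrK.
rewrite (le_lt_trans (schwartz_normD _ _ _))//.
have h1 := schwartz_normZ N (c - b) f.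
have h2 := schwartz_normZ N b (f - g).
have h3 : `|(b : Rcomplex R)| <= `|(c : Rcomplex R)| + `|(c - b : Rcomplex R)|.
  by have := ler_normB (c : Rcomplex R) (c - b : Rcomplex R); rewrite subKr.
have d1 : d <= 1 by rewrite /d ge_min lexx.
have dM : d * M <= e / 2 by rewrite -ler_pdivlMr// /d ge_min lexx orbT.
have f0 := schwartz_norm_ge0 N f.
have fg0 := schwartz_norm_ge0 N (f - g).
have cb0 : 0 <= `|(c - b : Rcomplex R)| by exact: normr_ge0.
have b0 : 0 <= `|(b : Rcomplex R)| by exact: normr_ge0.
have h4 : `|(c - b : Rcomplex R)| * schwartz_norm N f <= d * schwartz_norm N f.
  by rewrite ler_wpM2r// ltW.
have h5 : `|(b : Rcomplex R)| * schwartz_norm N (f - g)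
    <= (`|(c : Rcomplex R)| + 1) * d.
  by apply: ler_pM => //; [lra|exact: ltW].
have : d * schwartz_norm N f + (`|(c : Rcomplex R)| + 1) * d = d * M.
  by rewrite /M; ring.
lra.
Qed.

Lemma schwartz_locally_convex : exists2 B : set_system schwartz,
  (forall b, b \in B -> convex_set b) & basis B.
Proof.
pose b f N (e : R) := [set g | schwartz_norm N (f - g) < e].
exists [set A | exists f N e, A = b f N e].
  move=> A; rewrite inE => -[f [N [e ->]]].
  apply/convex_setW => g h; rewrite !inE /b /= => fg fh k k0 k1.
  rewrite inE /= -[X in f - X]/(k%:num *: g + (1 - k%:num) *: h).
  have nE (z : R[i]) : 0 <= z -> z = `|z : Rcomplex R|%:C.
    by move=> z0; rewrite -[LHS]ger0_norm.
  pose a : R := `|(k%:num : R[i]) : Rcomplex R|.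
  have kE : k%:num = a%:C by apply: nE; exact: ltW.
  have a0 : 0 < a by rewrite -ltcR -kE.
  have a1 : a < 1 by rewrite -ltcR -kE.
  have onem : `|(1 - k%:num : R[i]) : Rcomplex R| = 1 - a.
    have := nE (1 - k%:num); rewrite subr_ge0 => /(_ (ltW k1)).
    by rewrite {1}kE -(rmorphB _ 1 a) /= => /complexI.
  have -> : f - (k%:num *: g + (1 - k%:num) *: h) =
      k%:num *: (f - g) + (1 - k%:num) *: (f - h).
    by rewrite !scalerBr addrACA -scalerDl [k%:num + _]addrC subrK scale1r opprD.
  rewrite (le_lt_trans (schwartz_normD _ _ _))//.
  have h1 := schwartz_normZ N k%:num (f - g).
  have h2 := schwartz_normZ N (1 - k%:num) (f - h).
  rewrite onem in h2.
  rewrite (le_lt_trans (lerD h1 h2))// -/a.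
  have : a * schwartz_norm N (f - g) < a * e by rewrite ltr_pM2l.
  have : (1 - a) * schwartz_norm N (f - h) < (1 - a) * e.
    by rewrite ltr_pM2l// subr_gt0.
  lra.
split.
  move=> A [f [N [e ->]]]; rewrite openE => g /= fg.
  apply/nbhs_schwartzP; exists N, (e - schwartz_norm N (f - g)).
    by rewrite subr_gt0.
  move=> h gh; rewrite /b /= -(subrK g f) -addrA.
  by rewrite (le_lt_trans (schwartz_normD _ _ _))// -ltrBrDl.
move=> f A /nbhs_schwartzP[N [e e0 HA]]; exists (b f N e) => //.
by split; [exists f, N, e|rewrite /b /= subrr schwartz_norm0].
Qed.

HB.instance Definition _ :=
  PreTopologicalNmodule_isTopologicalNmodule.Build schwartz
    schwartz_add_continuous.
HB.instance Definition _ :=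
  TopologicalNmodule_isTopologicalLmodule.Build R[i] schwartz
    schwartz_scale_continuous.
HB.instance Definition _ :=
  Uniform_isTvs.Build R[i] schwartz schwartz_locally_convex.

End schwartz_space.

Section composition.
Variable R : realType.

Lemma schwartz_comp_subproof (phi : {poly R}) (f : schwartz R) :
  (1 < size phi)%N -> (fun x => f phi.[x]) \in @schwartz_pred R.
Proof.
by move=> phi1; apply/asboolP; apply: is_schwartz_comp => //; exact: schwartzP.
Qed.

Definition schwartz_comp (phi : {poly R}) (phi1 : (1 < size phi)%N)
  (f : schwartz R) : schwartz R := Schwartz (schwartz_comp_subproof f phi1).

Lemma schwartz_comp_is_linear (phi : {poly R}) (phi1 : (1 < size phi)%N) :
  linear (schwartz_comp phi1).
Proof. by move=> c f g; apply: schwartz_ext => x. Qed.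

HB.instance Definition _ (phi : {poly R}) (phi1 : (1 < size phi)%N) :=
  GRing.isLinear.Build R[i] (schwartz R) (schwartz R) _ (schwartz_comp phi1)
    (schwartz_comp_is_linear phi1).

End composition.

Section operators.
Variables (K : numFieldType) (X : tvsType K).
Implicit Type T : {linear X -> X}.

Definition spectrum T : set K :=
  [set l | ~ exists S : {linear X -> X}, [/\ continuous S,
     cancel (fun x => T x - l *: x) S & cancel S (fun x => T x - l *: x)]].

Definition cesaro_mean T (n : nat) (x : X) : X :=
  n%:R^-1 *: \sum_(1 <= k < n.+1) iter k T x.

Definition mean_ergodic T := exists P : {linear X -> X},
  continuous P /\ forall x, cesaro_mean T n x @[n --> \oo] --> P x.

End operators.

(* Main.v *)
Require Import Defs.
From HB Require Import structures.
From mathcomp Require Import all_boot all_order all_algebra.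
From mathcomp Require Import complex.
From mathcomp Require Import all_classical all_reals all_analysis.
From mathcomp Require Import ring lra.

(** Write [T] for composition with [phi]. The theorem holds because each side is
    equivalent to the absence of a real fixed point of [phi].

    Suppose [phi] has no fixed point. By the intermediate value theorem it moves
    all points in the same direction, and since its degree is at least two,
    every orbit escapes to infinity faster than any geometric sequence. This is
    encoded in a weight [w] ([orbit_growing_weight]) of polynomial size such that
    [w (phi x)] exceeds [w x] by any prescribed polynomial factor. As the
    derivatives of [f \o phi] are combinations of those of [f] at [phi] with
    polynomial coefficients, the supremum norms weighted by [w] define the
    topology of the Schwartz space and, for any chosen [r > 0], can be taken such
    that [T] contracts them by [r] ([contracting_seminorm]). Hence, for [l] not
    zero, [T - l] is injective with a bounded inverse ([resolvent_estimate]), and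
    onto by a fixed-point iteration and the completeness of the space
    ([schwartz_complete]); so no such [l] is in the spectrum. The same estimate
    bounds the sums of iterates, so the Cesaro means tend to [0]. Finally [0] is
    in the spectrum because [phi], having the same infinite limit at both ends,
    is not injective, which prevents [T] from being onto.

    Suppose [phi] has a fixed point [a]. Then [T f - f] vanishes at [a] for all
    [f], so [1] is in the spectrum. If the Cesaro means of a Gaussian converged,
    the limit would be a Schwartz function invariant under [phi], and so would
    vanish at all points with unbounded orbit. But the bounded orbits form a
    nonempty compact set, and at its largest point the limit is positive because
    the Gaussian is bounded below along the orbit, while just to the right of it
    the limit vanishes: this contradicts continuity
    ([fixpoint_not_mean_ergodic]). *)

Set Implicit Arguments.
Unset Strict Implicit.
Unset Printing Implicit Defensive.

Import Order.TTheory GRing.Theory Num.Theory.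
Import numFieldNormedType.Exports.

Local Open Scope classical_set_scope.
Local Open Scope ring_scope.

(** * Growth of a polynomial along its orbits *)

Section weights.
Variable R : realType.
Implicit Types phi : {poly R}.

(** A growth exponent larger than one makes the orbits that start far from the
    origin escape to infinity. *)
Lemma poly_quadratic_growth phi : (2 < size phi)%N ->
  exists2 A : R, 1 <= A & forall x : R, (1 + `|x|) ^+ 2 <= A * (1 + `|phi.[x]|).
Proof.
elim/poly_ind: phi => [|q c _]; first by rewrite size_poly0.
have [|q1 _] := leqP (size q) 1.
  move=> /size1_polyC ->; rewrite size_MXaddC; case: ifP => //.
  by rewrite ltnS ltnNge size_polyC_leq1.
have [A A0 HA] := poly_coercive q1.
pose T := 1 + A + `|c|.
have T0 : 0 <= `|c| := normr_ge0 c.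
exists (6 * (T + 1) ^+ 2) => [|x].
  by rewrite /T; nra.
rewrite hornerMXaddC.
have := ler_normB (q.[x] * x + c) c; rewrite addrK normrM.
have := HA x.
set X := `|x|; set Q := `|q.[x]|; set F := `|_ + c|.
have [X0 Q0 F0] : [/\ 0 <= X, 0 <= Q & 0 <= F] by split; exact: normr_ge0.
move=> h1 h2.
have h3 : X ^+ 2 <= A * (X + F + `|c|).
  have : X * X <= A * (1 + Q) * X by rewrite ler_wpM2r.
  have : A * (Q * X) <= A * (F + `|c|) by rewrite ler_wpM2l.
  lra.
have h4 : A * (X + F + `|c|) <= T * (X + F + T).
  by apply: ler_pM; rewrite ?addr_ge0// /T; lra.
have T1 : 1 <= T by rewrite /T; lra.
have h5 : 2 * T * X <= X ^+ 2 + T ^+ 2 by have := sqr_ge0 (X - T); nra.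
have h6 : 0 <= T * F by rewrite mulr_ge0//; lra.
have h7 : 0 <= T ^+ 2 * F by rewrite mulr_ge0// sqr_ge0.
have h8 : (1 + X) ^+ 2 <= 2 + 2 * X ^+ 2 by have := sqr_ge0 (1 - X); lra.
lra.
Qed.

(** By the intermediate value theorem the graph of a fixed-point free polynomial
    stays on one side of the diagonal; the sign [s] records which one. *)
Lemma fixpoint_free_sign phi : (forall x, phi.[x] != x) ->
  exists2 s : R, `|s| = 1 & forall x, s * x < s * phi.[x].
Proof.
move=> nofix; pose psi := phi - 'X.
have psiE x : psi.[x] = phi.[x] - x by rewrite /psi !hornerE.
have npsi x : psi.[x] != 0 by rewrite psiE subr_eq0.
have nopair (u v : R) : psi.[u] < 0 -> 0 < psi.[v] -> False.
  move=> u0 v0.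
  have [uv|vu] := leP u v.
    have [|x _ /rootP/eqP] := @poly_ivt R psi u v uv; last by apply/negP.
    by rewrite !ltW.
  have [|x _ /rootP/eqP] := @poly_ivt R (- psi) v u (ltW vu).
    by rewrite !hornerN oppr_le0 oppr_ge0 !ltW.
  by rewrite hornerN oppr_eq0; apply/negP.
have [p0|p0|/eqP] := ltgtP 0 psi.[0]; last by rewrite eq_sym (negbTE (npsi 0)).
  exists 1; first by rewrite normr1.
  move=> x; rewrite !mul1r -subr_gt0 -psiE lt_neqAle eq_sym npsi /= leNgt.
  by apply/negP => /nopair /(_ p0).
exists (-1); first by rewrite normrN normr1.
move=> x; rewrite !mulN1r ltrN2 -subr_lt0 -psiE lt_neqAle npsi /= leNgt.
by apply/negP => /(nopair _ _ p0).
Qed.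

(** The displacement [s * phi.[x] - s * x] is continuous and positive, so it
    attains a positive minimum on a compact interval. *)
Lemma fixpoint_free_gap phi (s L : R) : 0 <= L ->
    (forall x, s * x < s * phi.[x]) ->
  exists2 d : R, 0 < d & forall x : R, `|x| <= L -> s * x + d <= s * phi.[x].
Proof.
move=> L0 sphi; pose psi := s *: (phi - 'X).
have psiE x : psi.[x] = s * phi.[x] - s * x by rewrite /psi !hornerE mulrBr.
have LL : - L <= L by lra.
have [c _ cmin] : exists2 c, c \in `[- L, L]%R &
    forall t, t \in `[- L, L]%R -> psi.[c] <= psi.[t].
  apply: EVT_min => //; apply: continuous_subspaceT.
  exact: continuous_horner.
exists psi.[c]; first by rewrite psiE subr_gt0.
move=> x; rewrite ler_norml => xL; have := cmin x; rewrite in_itv /= xL => /(_ isT).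
by rewrite !psiE; lra.
Qed.

(** Far out, the quadratic growth of [phi] makes a power of [1 + `|x|] grow
    along orbits as fast as wanted. On the remaining compact set that power is
    corrected by the exponential of a bounded multiple of [s * x], which
    increases along orbits because [s * phi.[x] >= s * x + d]. *)
Lemma orbit_growing_weight phi (N m : nat) (rho : R) :
    (2 < size phi)%N -> (forall x, phi.[x] != x) -> 0 <= rho ->
  exists w : R -> R, exists B : R, exists M : nat,
    [/\ 0 <= B, forall x : R, (1 + `|x|) ^+ N <= w x,
        forall x : R, w x <= B * (1 + `|x|) ^+ M &
        forall x : R, rho * (1 + `|x|) ^+ m * w x <= w phi.[x]].
Proof.
move=> phi2 nofix rho0.
have [A A1 HA] := poly_quadratic_growth phi2.
have [s s1 sphi] := fixpoint_free_sign nofix.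
have A0 : 0 <= A by lra.
(* In the ratio of the powers, [phi] gains [(1 + `|x|) ^+ k]; of this, [m]
   factors pay for [(1 + `|x|) ^+ m], and one of the others pays for
   [rho * A ^+ k] as soon as it exceeds [L]. *)
pose k := (m + N).+1.
pose L := rho * A ^+ k.
have L0 : 0 <= L by rewrite mulr_ge0 ?exprn_ge0.
have [d d0 dgap] := fixpoint_free_gap L0 sphi.
(* [cl] truncates to [-L, L + d], shifted so as to be nonnegative: a point of
   [-L, L] moved by [d] is still in the range where [cl] is a translation. *)
pose cl (y : R) := Num.min (Num.max y (- L)) (L + d) + L.
have cl_mono y z : y <= z -> cl y <= cl z.
  move=> yz; rewrite lerD2r le_min !ge_min lexx orbT andbT.
  by rewrite ge_max !le_max yz lexx !orbT.
have cl_ge0 y : 0 <= cl y.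
  by rewrite -lerBlDr sub0r le_min le_max lexx orbT /=; lra.
have cl_le y : cl y <= 2 * L + d.
  have : Num.min (Num.max y (- L)) (L + d) <= L + d by rewrite ge_min lexx orbT.
  by rewrite /cl; lra.
have cl_id y : - L <= y <= L + d -> cl y = y + L.
  by move=> /andP[y1 y2]; rewrite /cl (max_idPl y1) (min_idPl y2).
have k0 : 0 <= L / d by rewrite divr_ge0// ltW.
(* The rate [L / d] is chosen so that a gain of [d] in [cl] multiplies [h] by
   [expR L], which is at least [L]. *)
pose h x := expR (L / d * cl (s * x)).
have h_ge1 x : 1 <= h x by rewrite -expR0 ler_expR mulr_ge0.
have h_mono x : h x <= h phi.[x].
  by rewrite ler_expR ler_wpM2l// cl_mono// ltW.
have x1 (x : R) : 1 <= 1 + `|x| by rewrite lerDl.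
have x0 (x : R) : 0 <= 1 + `|x| by rewrite addr_ge0.
exists (fun x => (1 + `|x|) ^+ k * h x), (expR (L / d * (2 * L + d))), k.
split => [|x|x|x]; first exact: expR_ge0.
- rewrite -[leLHS]mulr1 ler_pM// ?exprn_ge0//.
  by rewrite ler_weXn2l// /k leqW// leq_addl.
- by rewrite mulrC ler_wpM2r ?exprn_ge0// ler_expR ler_wpM2l.
have main : L * h x <= (1 + `|x|) * h phi.[x].
  have [xL|/ltW xL] := leP (1 + `|x|) L; last first.
    by apply: ler_pM => //; exact: expR_ge0.
  have xL' : `|x| <= L by lra.
  have sx : cl (s * x) = s * x + L.
    have : `|s * x| <= L by rewrite normrM s1 mul1r.
    by rewrite ler_norml => /andP[? ?]; apply: cl_id; apply/andP; split; lra.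
  have sx' : cl (s * x) + d <= cl (s * phi.[x]).
    apply: (@le_trans _ _ (cl (s * x + d))); last exact/cl_mono/dgap.
    have : `|s * x| <= L by rewrite normrM s1 mul1r.
    rewrite ler_norml => /andP[? ?]; rewrite sx [leRHS]cl_id; first by lra.
    by apply/andP; split; lra.
  apply: (@le_trans _ _ (1 * h phi.[x])); last first.
    by rewrite ler_wpM2r// expR_ge0.
  rewrite mul1r; apply: (@le_trans _ _ (expR L * h x)).
    by rewrite ler_wpM2r ?expR_ge0//; have := expR_ge1Dx L; lra.
  rewrite -expRD ler_expR.
  rewrite (_ : L + L / d * cl (s * x) = L / d * (cl (s * x) + d)).
    by rewrite ler_wpM2l.
  by field; rewrite gt_eqF.
have grow : (1 + `|x|) ^+ (m + k).+1 <= A ^+ k * (1 + `|phi.[x]|) ^+ k.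
  rewrite -exprMn; apply: (@le_trans _ _ (((1 + `|x|) ^+ 2) ^+ k)).
    by rewrite -exprM ler_weXn2l// mul2n -addnn -addSn leq_add2r ltnS leq_addr.
  by rewrite lerXn2r// nnegrE ?exprn_ge0// mulr_ge0.
have Ak : 0 < A ^+ k by rewrite exprn_gt0//; lra.
rewrite -(ler_pM2l Ak).
have -> : A ^+ k * (rho * (1 + `|x|) ^+ m * ((1 + `|x|) ^+ k * h x)) =
    (1 + `|x|) ^+ (m + k) * (L * h x) by rewrite exprD /L; ring.
apply: (@le_trans _ _ ((1 + `|x|) ^+ (m + k) * ((1 + `|x|) * h phi.[x]))).
  by rewrite ler_wpM2l// exprn_ge0.
by rewrite !mulrA -exprSr ler_wpM2r ?expR_ge0.
Qed.

End weights.

(** * Contracting norms *)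

Section derivatives_of_composites.
Variable R : realType.
Implicit Types phi : {poly R}.

(** Coefficients of the formula of Faa di Bruno: the [j]-th derivative of
    [f \o phi] is the sum over [l <= j] of [compder phi j l] times the [l]-th
    derivative of [f] taken at [phi]. *)
Fixpoint compder phi (j l : nat) : {poly R} :=
  if j is j'.+1 then
    (compder phi j' l)^`() + (if l is l'.+1 then compder phi j' l' * phi^`() else 0)
  else (l == 0)%N%:R.

Lemma compder_eq0 phi j l : (j < l)%N -> compder phi j l = 0.
Proof.
elim: j l => [|j IH] [|l] //= jl.
by rewrite IH ?(ltnW jl)// deriv0 add0r IH// mul0r.
Qed.

Lemma derive1n_comp phi (f : R -> Rcomplex R) (j : nat) : smooth f ->
  derive1n j (fun x => f phi.[x]) =
  (fun x => \sum_(l < j.+1) (compder phi j l).[x] *: derive1n l f phi.[x]).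
Proof.
move=> fs; elim: j => [|j IH].
  by apply/funext => x; rewrite big_ord1 /= hornerC scale1r.
rewrite derive1nS IH; apply: derive1_fun => x.
have dF l := is_derive_derive1 (fs l phi.[x]).
have {dF} dF (l : nat) := is_derive_poly_comp (compder phi j l) (dF l).
have -> : (fun y => \sum_(l < j.+1) (compder phi j l).[y] *: derive1n l f phi.[y])
   = \sum_(l < j.+1) (fun y => (compder phi j l).[y] *: derive1n l f phi.[y]).
  by apply/funext => y; rewrite fct_sumE.
apply: is_derive_eq (is_derive_sum (fun l : 'I_j.+1 => dF l)) _.
rewrite big_split /=.
have -> : \sum_(l < j.+1) ((compder phi j l)^`()).[x] *: derive1n l f phi.[x] =
   \sum_(l < j.+2) ((compder phi j l)^`()).[x] *: derive1n l f phi.[x].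
  by rewrite [RHS]big_ord_recr /= compder_eq0// deriv0 horner0 scale0r addr0.
under [RHS]eq_bigr do rewrite /= hornerD scalerDl.
rewrite [RHS]big_split; congr (_ + _).
by rewrite [RHS]big_ord_recl /= horner0 scale0r add0r.
Qed.

Definition poly_dominated (F : R -> R) := exists (B : R) (m : nat),
  0 <= B /\ forall x : R, F x <= B * (1 + `|x|) ^+ m.

Lemma poly_dominated_sum n (F : 'I_n -> R -> R) :
  (forall i, poly_dominated (F i)) -> poly_dominated (fun x => \sum_i F i x).
Proof.
elim: n F => [|n IH] F HF.
  by exists 0, 0%N; split => // x; rewrite big_ord0 mul0r.
have [B [m [B0 HB]]] := IH (fun i => F (widen_ord (leqnSn n) i)) (fun i => HF _).
have [C [k [C0 HC]]] := HF ord_max.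
exists (B + C), (m + k)%N; split; first exact: addr_ge0.
move=> x; rewrite big_ord_recr /= mulrDl.
have x1 : 1 <= 1 + `|x| by rewrite lerDl.
apply: lerD.
  by rewrite (le_trans (HB x))// ler_wpM2l// ler_weXn2l// leq_addr.
by rewrite (le_trans (HC x))// ler_wpM2l// ler_weXn2l// leq_addl.
Qed.

Lemma derive1n_comp_bound phi (N : nat) : exists (C : R) (m : nat), 0 <= C /\
  forall (f : R -> Rcomplex R) (K x : R), smooth f ->
  (forall l, (l <= N)%N -> `|derive1n l f phi.[x]| <= K) ->
  forall j, (j <= N)%N ->
  `|derive1n j (fun y => f phi.[y]) x| <= C * (1 + `|x|) ^+ m * K.
Proof.
have [C [m [C0 HC]]] : poly_dominated (fun x =>
    \sum_(j < N.+1) \sum_(l < j.+1) `|(compder phi j l).[x]|).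
  apply: poly_dominated_sum => j; apply: poly_dominated_sum => l.
  exact: poly_growth.
exists C, m; split => // f K x fs HK j jN.
have K0 : 0 <= K by apply: le_trans (HK 0%N _).
rewrite derive1n_comp//.
apply: (@le_trans _ _ (\sum_(l < j.+1) `|(compder phi j l).[x]| * K)).
  apply: (le_trans (ler_norm_sum _ _ _)); apply: ler_sum => l _.
  rewrite Rcomplex_normZ ler_wpM2l// HK//.
  by rewrite (leq_trans _ jN)// -ltnS.
rewrite -mulr_suml ler_wpM2r// (le_trans _ (HC x))//.
rewrite (bigD1 (Ordinal (jN : (j < N.+1)%N)))//= lerDl.
by apply: sumr_ge0 => i _; apply: sumr_ge0.
Qed.

End derivatives_of_composites.

Section weighted_norms.
Variable R : realType.
Implicit Types f g : schwartz R.

Section weight.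
Variables (w : R -> R) (B : R) (M N : nat).
Hypothesis w_ge : forall x : R, (1 + `|x|) ^+ N <= w x.
Hypothesis w_le : forall x : R, w x <= B * (1 + `|x|) ^+ M.
Hypothesis B_ge0 : 0 <= B.

Definition weighted_norm f : R :=
  sup [set r | exists j x, (j <= N)%N /\
     r = w x * `|derive1n j (f : R -> Rcomplex R) x|].

Lemma weight_ge1 x : 1 <= w x.
Proof. by apply: le_trans (w_ge x); rewrite exprn_ege1// lerDl. Qed.

Lemma weighted_bounded f j (x : R) : (j <= N)%N ->
  w x * `|derive1n j (f : R -> Rcomplex R) x|
  <= B * 2 ^+ M.+1 * schwartz_norm (maxn M N) f.
Proof.
move=> jN; set F := `|_|.
have F0 : 0 <= F by exact: normr_ge0.
have jM : (j <= maxn M N)%N := leq_trans jN (leq_maxr _ _).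
have h0 := @schwartz_norm_ub R (maxn M N) f 0%N j x (leq0n _) jM.
have h1 := @schwartz_norm_ub R (maxn M N) f M j x (leq_maxl _ _) jM.
rewrite -/F expr0 mul1r in h0; rewrite -/F in h1.
apply: (@le_trans _ _ (B * (2 ^+ M * (1 + `|x| ^+ M)) * F)); last first.
  by rewrite -!mulrA ler_wpM2l// exprSr -mulrA ler_wpM2l ?exprn_ge0//; lra.
rewrite ler_wpM2r// (le_trans (w_le x))// ler_wpM2l//.
have [x1|/ltW x1] := leP `|x| 1.
  apply: (@le_trans _ _ (2 ^+ M)).
    by rewrite lerXn2r ?nnegrE ?addr_ge0//; lra.
  by rewrite ler_peMr ?exprn_ge0// lerDl exprn_ge0.
apply: (@le_trans _ _ ((2 * `|x|) ^+ M)).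
  by rewrite lerXn2r ?nnegrE ?addr_ge0 ?mulr_ge0//; lra.
by rewrite exprMn ler_wpM2l ?exprn_ge0// lerDr.
Qed.

Lemma weighted_norm_ub f j (x : R) : (j <= N)%N ->
  w x * `|derive1n j (f : R -> Rcomplex R) x| <= weighted_norm f.
Proof.
move=> jN; apply: ub_le_sup; last by exists j, x.
exists (B * 2 ^+ M.+1 * schwartz_norm (maxn M N) f).
by move=> _ [k [y [kN ->]]]; exact: weighted_bounded.
Qed.

Lemma weighted_norm_le f K :
  (forall j (x : R), (j <= N)%N ->
     w x * `|derive1n j (f : R -> Rcomplex R) x| <= K) ->
  weighted_norm f <= K.
Proof.
move=> H; apply: ge_sup; last by move=> _ [j [x [jN ->]]]; exact: H.
by exists (w 0 * `|derive1n 0 (f : R -> Rcomplex R) 0|), 0%N, 0.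
Qed.

Lemma weighted_normD f g :
  weighted_norm (f + g) <= weighted_norm f + weighted_norm g.
Proof.
apply: weighted_norm_le => j x jN; rewrite derive1n_schwartzD.
apply: le_trans (lerD (weighted_norm_ub f x jN) (weighted_norm_ub g x jN)).
by rewrite -mulrDr ler_wpM2l ?ler_normD// (le_trans ler01)// weight_ge1.
Qed.

Lemma weighted_normZ (c : R[i]) f :
  weighted_norm (c *: f) <= `|c : Rcomplex R| * weighted_norm f.
Proof.
apply: weighted_norm_le => j x jN; rewrite derive1n_schwartzZ.
by rewrite Rcomplex_normM mulrCA ler_wpM2l// weighted_norm_ub.
Qed.

Lemma schwartz_norm_le_weighted f : schwartz_norm N f <= weighted_norm f.
Proof.
apply: schwartz_norm_le => i j x iN jN.
apply: le_trans (weighted_norm_ub f x jN).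
rewrite ler_wpM2r// (le_trans _ (w_ge x))//.
apply: (@le_trans _ _ ((1 + `|x|) ^+ i)).
  by rewrite lerXn2r ?nnegrE ?addr_ge0// lerDr.
by rewrite ler_weXn2l// lerDl.
Qed.

Lemma weighted_le_schwartz_norm f :
  weighted_norm f <= B * 2 ^+ M.+1 * schwartz_norm (maxn M N) f.
Proof. by apply: weighted_norm_le => j x jN; exact: weighted_bounded. Qed.

End weight.

(** Without fixed points the operator is a contraction of every ratio [r > 0]
    for suitable norms defining the topology: differentiating [f \o phi] costs a
    factor polynomial in [x], which the growth of the weight along orbits
    absorbs. *)
Lemma contracting_seminorm (phi : {poly R}) (phi1 : (1 < size phi)%N)
    (N : nat) (r : R) : (2 < size phi)%N -> (forall x, phi.[x] != x) -> 0 < r ->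
  exists p : schwartz R -> R, exists C (M : nat),
   [/\ [/\ 0 <= C, forall f g, p (f + g) <= p f + p g &
           forall (c : R[i]) f, p (c *: f) <= `|c : Rcomplex R| * p f],
       forall f, schwartz_norm N f <= p f,
       forall f, p f <= C * schwartz_norm M f &
       forall f, p (schwartz_comp phi1 f) <= r * p f].
Proof.
move=> phi2 nofix r0.
have [C [m [C0 HC]]] := derive1n_comp_bound phi N.
have Cr : 0 <= C / r by rewrite divr_ge0// ltW.
have [w [B [M [B0 w_ge w_le w_grow]]]] := orbit_growing_weight N m phi2 nofix Cr.
exists (weighted_norm w N), (B * 2 ^+ M.+1), (maxn M N); split.
- split; first by rewrite mulr_ge0// exprn_ge0.
  + exact: (weighted_normD w_ge w_le B0).
  + exact: (weighted_normZ N w_le B0).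
- exact: (schwartz_norm_le_weighted w_ge w_le B0).
- exact: (weighted_le_schwartz_norm N w_le B0).
- move=> f; apply: weighted_norm_le => j x jN.
  have w0 y : 0 < w y by rewrite (lt_le_trans ltr01)// (weight_ge1 w_ge).
  have [fs _] := schwartzP f.
  have pf l : (l <= N)%N -> `|derive1n l (f : R -> Rcomplex R) phi.[x]|
      <= weighted_norm w N f / w phi.[x].
    move=> lN; rewrite ler_pdivlMr// mulrC.
    exact: (weighted_norm_ub w_le B0 f _ lN).
  have := HC _ _ _ fs pf j jN.
  have p0 : 0 <= weighted_norm w N f.
    apply: le_trans (schwartz_norm_le_weighted w_ge w_le B0 f).
    exact: schwartz_norm_ge0.
  rewrite -(ler_pM2l (w0 x)) => /le_trans; apply.
  rewrite [leLHS](_ : _ = w x * C * (1 + `|x|) ^+ m / w phi.[x]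
    * weighted_norm w N f); last by ring.
  rewrite ler_wpM2r// ler_pdivrMr//.
  have := w_grow x; rewrite -(ler_pM2l r0); apply: le_trans.
  by rewrite le_eqVlt; apply/orP; left; apply/eqP; field; rewrite gt_eqF.
Qed.

End weighted_norms.

(** * Completeness of the Schwartz space *)

Section completeness.
Variable R : realType.

(** The limit is the supremum of the lower bounds [a n - e n], each of which is
    below every upper bound [a m + e m]. *)
Lemma real_limit_with_rate (a e : nat -> R) :
  (forall n m, (n <= m)%N -> `|a n - a m| <= e n) ->
  exists l, forall n, `|a n - l| <= e n.
Proof.
move=> ae; have e0 n : 0 <= e n by have := ae n n (leqnn n); rewrite subrr normr0.
have cross n m : a n - e n <= a m + e m.
  have := e0 n; have := e0 m.
  by case: (leqP n m) => [/ae|/ltnW/ae]; rewrite ler_norml => /andP[]; lra.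
pose E := [set r | exists n, r = a n - e n].
have ubE m : ubound E (a m + e m) by move=> _ [n ->]; exact: cross.
exists (sup E) => n; rewrite ler_norml.
have : a n - e n <= sup E.
  by apply: ub_le_sup; [exists (a 0%N + e 0%N); exact: ubE|exists n].
have : sup E <= a n + e n by apply: ge_sup; [exists (a n - e n), n|exact: ubE].
by move=> ? ?; apply/andP; split; lra.
Qed.

Lemma Rcomplex_norm_le (z : Rcomplex R) :
  `|z| <= `|complex.Re z| + `|complex.Im z|.
Proof.
case: z => a b; rewrite [leLHS]/Num.norm /=.
rewrite -[leRHS]ger0_norm ?addr_ge0// -sqrtr_sqr ler_sqrt ?sqr_ge0//.
rewrite sqrrD !real_normK ?num_real// lerD2r lerDl mulrn_wge0// mulr_ge0//.
Qed.

Lemma Rcomplex_limit_with_rate (z : nat -> Rcomplex R) (e : nat -> R) :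
  (forall n m, (n <= m)%N -> `|z n - z m| <= e n) ->
  exists l, forall n, `|z n - l| <= 2 * e n.
Proof.
move=> ze.
have [n m nm|a Ha] := @real_limit_with_rate (fun n => complex.Re (z n)) e.
  by rewrite -raddfB (le_trans (Rcomplex_Re_le _))// ze.
have [n m nm|b Hb] := @real_limit_with_rate (fun n => complex.Im (z n)) e.
  by rewrite -raddfB (le_trans (Rcomplex_Im_le _))// ze.
exists (a +i* b)%C => n; rewrite (le_trans (Rcomplex_norm_le _))//.
rewrite !raddfB /= mulr_natl mulr2n; exact: lerD (Ha n) (Hb n).
Qed.

Lemma le_of_vanishing_error (a b : R) (e : nat -> R) :
  e n @[n --> \oo] --> 0 -> (forall n, a <= b + e n) -> a <= b.
Proof.
move=> e0 H; apply/ler_addgt0Pr => d d0.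
have /cvgrPdist_le/(_ _ d0)[n _ /(_ n (leqnn n))] := e0.
rewrite sub0r normrN => /(le_trans (ler_norm _)) en.
by rewrite (le_trans (H n))// lerD2l.
Qed.

Lemma mean_value (f df : R -> R) (x h : R) :
  (forall y : R, is_derive y 1 f (df y)) ->
  exists2 c, `|c - x| <= `|h| & f (x + h) - f x = df c * h.
Proof.
move=> fdf.
have fc : continuous f.
  move=> y; apply: differentiable_continuous; apply/derivable1_diffP.
  by have [] := fdf y.
have [h0|/ltW h0] := leP 0 h.
  have [||c] := @MVT_segment R f df x (x + h) _ (fun y _ => fdf y) _.
  - by rewrite lerDl.
  - exact: continuous_subspaceT.
  rewrite in_itv /= => /andP[? ?] E; exists c.
    by rewrite ger0_norm ?(ger0_norm h0); lra.
  by rewrite E; congr (_ * _); ring.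
have [||c] := @MVT_segment R f df (x + h) x _ (fun y _ => fdf y) _.
- by rewrite gerDl.
- exact: continuous_subspaceT.
rewrite in_itv /= => /andP[? ?] E; exists c.
  by rewrite ler0_norm ?(ler0_norm h0); lra.
by rewrite -opprB E; ring.
Qed.

(** Two applications of the mean value theorem: the price is the constant [B]
    in place of [B / 2]. *)
Lemma real_taylor2 (f f1 f2 : R -> R) (B x h : R) :
  (forall y : R, is_derive y 1 f (f1 y)) ->
  (forall y : R, is_derive y 1 f1 (f2 y)) ->
  (forall y, `|f2 y| <= B) -> `|f (x + h) - f x - h * f1 x| <= B * h ^+ 2.
Proof.
move=> f1E f2E f2B.
have [c ch ->] := mean_value x h f1E.
have [c' _] := mean_value x (c - x) f2E.
rewrite (addrC x (c - x)) subrK => E.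
rewrite [X in `|X|](_ : _ = f2 c' * (c - x) * h); last by rewrite -E; ring.
rewrite !normrM -(real_normK (num_real h)) expr2 mulrA.
by rewrite ler_wpM2r// ler_pM.
Qed.

Lemma Rcomplex_taylor2 (f f1 f2 : R -> Rcomplex R) (B x h : R) :
  (forall y : R, is_derive y 1 f (f1 y)) ->
  (forall y : R, is_derive y 1 f1 (f2 y)) ->
  (forall y, `|f2 y| <= B) ->
  `|f (x + h) - f x - h *: f1 x| <= 2 * B * h ^+ 2.
Proof.
move=> f1E f2E f2B.
have re := @real_taylor2 _ _ _ B x h
  (fun y => ((is_derive_ReIm _ _ _).1 (f1E y)).1)
  (fun y => ((is_derive_ReIm _ _ _).1 (f2E y)).1)
  (fun y => le_trans (Rcomplex_Re_le _) (f2B y)).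
have im := @real_taylor2 _ _ _ B x h
  (fun y => ((is_derive_ReIm _ _ _).1 (f1E y)).2)
  (fun y => ((is_derive_ReIm _ _ _).1 (f2E y)).2)
  (fun y => le_trans (Rcomplex_Im_le _) (f2B y)).
rewrite (le_trans (Rcomplex_norm_le _))//.
rewrite -mulrA mulr_natl mulr2n; apply: le_trans (lerD re im).
by case: (f (x + h)) (f x) (f1 x) => [? ?] [? ?] [? ?].
Qed.

(** This turns differentiability of a limit into an inequality without
    quotients, which passes to the limit. *)
Lemma is_derive_of_quadratic_error (V : normedModType R) (G : R -> V) (D : V)
    (C x : R) :
  (forall h, `|G (x + h) - G x - h *: D| <= C * h ^+ 2) -> is_derive x 1 G D.
Proof.
move=> H.
have C0 : 0 <= C by have := H 1; rewrite expr1n mulr1; apply: le_trans.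
have cv : h^-1 *: ((G \o shift x) (h *: 1) - G x) @[h --> 0^'] --> D.
  apply/cvgrPdist_le => e e0; near=> h.
  have h0 : h != 0 by near: h; exact: nbhs_dnbhs_neq.
  rewrite /= [h *: 1]mulr1 (addrC h x).
  rewrite [X in `|X|](_ : _ = - (h^-1 *: (G (x + h) - G x - h *: D))); last first.
    by rewrite [in RHS]scalerBr scalerA mulVf// scale1r opprB addrC.
  rewrite normrN normrZ normfV ler_pdivrMl ?normr_gt0//.
  rewrite (le_trans (H h))// -(real_normK (num_real h)) expr2 mulrCA.
  rewrite ler_wpM2l//.
  apply: (@le_trans _ _ ((C + 1) * `|h|)); first by rewrite ler_wpM2r// lerDl.
  rewrite -ler_pdivlMl; last by lra.
  near: h; apply: dnbhs0_le.
  by rewrite mulr_gt0// invr_gt0; lra.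
split; first by apply/cvg_ex; exists D.
exact: cvg_lim cv.
Unshelve. all: by end_near. Qed.

Lemma derive1n_schwartzB n (f g : schwartz R) (x : R) :
  derive1n n (f - g : R -> Rcomplex R) x =
  derive1n n (f : R -> Rcomplex R) x - derive1n n (g : R -> Rcomplex R) x.
Proof.
by rewrite -[X in derive1n n X]/((f + - g : schwartz R) : R -> R[i])
  derive1n_schwartzD -scaleN1r derive1n_schwartzZ mulN1r.
Qed.

(** Completeness of the Schwartz space. The derivatives of each order converge
    pointwise with a rate; that the limits are derivatives of one another
    follows by letting the sequence tend to its limit in Taylor's inequality
    [`|g (x + h) - g x - h *: g' x| <= C * h ^+ 2], whose constant depends only
    on a bound for the second derivatives, uniform along the sequence. *)
Lemma schwartz_complete (u : nat -> schwartz R) (e : nat -> nat -> R) :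
    (forall N, e N n @[n --> \oo] --> 0) ->
    (forall N n m, (n <= m)%N -> schwartz_norm N (u n - u m) <= e N n) ->
  exists G : schwartz R, forall N n, schwartz_norm N (u n - G) <= e N n.
Proof.
move=> ecv ue.
pose d j n (x : R) : Rcomplex R := derive1n j (u n : R -> Rcomplex R) x.
have dE j n (y : R) : is_derive y 1 (d j n : R -> Rcomplex R) (d j.+1 n y).
  by have [us _] := schwartzP (u n); exact: is_derive_derive1 (us j y).
have du N i j n m x : (i <= N)%N -> (j <= N)%N -> (n <= m)%N ->
    `|x| ^+ i * `|d j n x - d j m x| <= e N n.
  move=> iN jN nm; apply: le_trans (ue N n m nm).
  by rewrite -derive1n_schwartzB; exact: schwartz_norm_ub.
have lim j x : exists l, forall n, `|d j n x - l| <= 2 * e j n.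
  apply: Rcomplex_limit_with_rate => n m nm.
  by have := du j 0%N j n m x (leq0n _) (leqnn _) nm; rewrite expr0 mul1r.
pose G j x := sval (cid (lim j x)).
have GP j x n : `|d j n x - G j x| <= 2 * e j n := svalP (cid (lim j x)) n.
(* [GP] controls the unweighted difference only; the weight [`|x| ^+ i] is
   recovered by going through an index [k + n] that tends to infinity with
   [x] fixed. *)
have GN N i j n x : (i <= N)%N -> (j <= N)%N ->
    `|x| ^+ i * `|d j n x - G j x| <= e N n.
  move=> iN jN.
  apply: (@le_of_vanishing_error _ _ (fun k => `|x| ^+ i * (2 * e j (k + n)%N))).
    rewrite -(mulr0 (`|x| ^+ i)); apply: cvgMr.
    rewrite -(mulr0 2); apply: cvgMr.
    by rewrite cvg_shiftn; exact: ecv.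
  move=> k; have := du N i j n (k + n)%N x iN jN (leq_addl _ _).
  have /(ler_wpM2l (exprn_ge0 i (normr_ge0 x))) := GP j x (k + n)%N.
  move=> h1 h2; apply: le_trans (lerD h2 h1); rewrite -mulrDr.
  rewrite ler_wpM2l ?exprn_ge0//.
  by apply: le_trans (ler_normD _ _); rewrite addrA subrK.
have bnd i j : exists B, forall n x, `|x| ^+ i * `|d j n x| <= B.
  pose N := maxn i j.
  exists (schwartz_norm N (u 0%N) + e N 0%N) => n x.
  have iN : (i <= N)%N by rewrite leq_maxl.
  have jN : (j <= N)%N by rewrite leq_maxr.
  have h1 := schwartz_norm_ub (u 0%N) x iN jN.
  have h2 := du N i j 0%N n x iN jN (leq0n _).
  apply: le_trans (lerD h1 h2); rewrite -mulrDr ler_wpM2l ?exprn_ge0//.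
  by rewrite -/(d j 0%N x) -{1}(subKr (d j 0%N x) (d j n x)) ler_normB.
have GE j (x : R) : is_derive x 1 (G j) (G j.+1 x).
  have [B HB] := bnd 0%N j.+2.
  apply: (@is_derive_of_quadratic_error (Rcomplex R) _ _ (2 * B)) => h.
  pose err n := 2 * e j n + 2 * e j n + `|h| * (2 * e j.+1 n).
  apply: (@le_of_vanishing_error _ _ err).
    rewrite (_ : 0 = 2 * 0 + 2 * 0 + `|h| * (2 * 0)); last by ring.
    by apply: cvgD; [apply: cvgD|]; do ?apply: cvgMr; exact: ecv.
  move=> n.
  have T : `|d j n (x + h) - d j n x - h *: d j.+1 n x| <= 2 * B * h ^+ 2.
    apply: (Rcomplex_taylor2 _ _ (dE j n) (dE j.+1 n)) => y.
    by have := HB n y; rewrite expr0 mul1r.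
  have E1 := GP j (x + h) n.
  have E2 := GP j x n.
  have E3 : `|h *: (d j.+1 n x - G j.+1 x)| <= `|h| * (2 * e j.+1 n).
    by rewrite Rcomplex_normZ ler_wpM2l.
  have -> : G j (x + h) - G j x - h *: G j.+1 x =
      (d j n (x + h) - d j n x - h *: d j.+1 n x)
      - (d j n (x + h) - G j (x + h)) + (d j n x - G j x)
      + h *: (d j.+1 n x - G j.+1 x).
    rewrite scalerBr.
    move: (d j n _) (d j n _) (h *: _) (h *: _) (G j _) (G j _) => a1 a2 a3 a4 a5 a6.
    by ring.
  rewrite [leRHS](_ : _ = 2 * B * h ^+ 2 + 2 * e j n + 2 * e j n +
    `|h| * (2 * e j.+1 n)); last by rewrite /err !addrA.
  apply: (le_trans (ler_normD _ _)); apply: lerD E3.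
  apply: (le_trans (ler_normD _ _)); apply: lerD E2.
  apply: (le_trans (ler_normB _ _)); exact: lerD T E1.
have GS : is_schwartz (G 0%N).
  apply: (@is_schwartz_coind R (fun f => exists j, f = G j)); last by exists 0%N.
    by move=> f [j ->]; exists (G j.+1) => //; exists j.+1.
  move=> f [j ->] i; have [B HB] := bnd i j; pose N := maxn i j.
  exists (B + e N 0%N) => x.
  have h := GN N i j 0%N x (leq_maxl _ _) (leq_maxr _ _).
  apply: le_trans (lerD (HB 0%N x) h); rewrite -mulrDr ler_wpM2l ?exprn_ge0//.
  by rewrite -{1}(subKr (d j 0%N x) (G j x)) ler_normB.
have GSp : G 0%N \in @schwartz_pred R by apply/asboolP.
exists (Schwartz GSp) => N n; apply: schwartz_norm_le => i j x iN jN.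
rewrite derive1n_schwartzB (_ : derive1n j (Schwartz GSp : R -> Rcomplex R) = G j).
  exact: GN.
elim: j {jN} => [//|j IH].
by rewrite derive1nS IH; exact: derive1_fun.
Qed.

End completeness.

(** * Seminorms and the resolvent estimate *)

Section seminorms.
Variable R : realType.
Implicit Types f g : schwartz R.

Lemma Rcomplex_norm_nat n : `|(n%:R : R[i]) : Rcomplex R| = n%:R.
Proof.
rewrite -(rmorph_nat (real_complex R)) [LHS]/Num.norm /=.
by rewrite expr0n addr0 sqrtr_sqr ger0_norm.
Qed.

Lemma Rcomplex_normV (c : R[i]) : c != 0 ->
  `|(c^-1 : R[i]) : Rcomplex R| = `|c : Rcomplex R|^-1.
Proof.
move=> c0; have n0 : `|c : Rcomplex R| != 0 by rewrite normr_eq0.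
apply: (mulIf n0); rewrite mulVf// -Rcomplex_normM mulVf//.
exact: (Rcomplex_norm_nat 1).
Qed.

Lemma Rcomplex_norm_le0 (z : R[i]) : `|z : Rcomplex R| <= 0 -> z = 0.
Proof. by rewrite normr_le0 => /eqP. Qed.

Lemma schwartz_norm_eq0 f : schwartz_norm 0 f <= 0 -> f = 0.
Proof.
move=> f0; apply: schwartz_ext => x.
have := schwartz_norm_ub f x (leqnn 0) (leqnn 0).
rewrite expr0 mul1r => /le_trans /(_ f0).
by rewrite normr_le0 => /eqP.
Qed.

Lemma schwartz_sumE (I : Type) (s : seq I) (F : I -> schwartz R) (x : R) :
  (\sum_(i <- s) F i) x = \sum_(i <- s) F i x.
Proof. by elim/big_rec2: _ => // i y z _ <-. Qed.

Lemma schwartz_cvg_pointwise (u : nat -> schwartz R) (G : schwartz R) (e : R) :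
  u n @[n --> \oo] --> G -> 0 < e ->
  exists n0, forall n x, (n0 <= n)%N -> `|(G x - u n x : Rcomplex R)| < e.
Proof.
move=> uG e0.
have /uG[n0 _ H] : nbhs G [set g | schwartz_norm 0 (G - g) < e].
  by apply/nbhs_schwartzP; exists 0%N, e.
exists n0 => n x n0n; apply: le_lt_trans (H n n0n).
have := schwartz_norm_ub (G - u n) x (leqnn 0) (leqnn 0).
by rewrite expr0 mul1r.
Qed.

Lemma schwartz_linear_continuous (S : {linear schwartz R -> schwartz R}) :
  (forall N, exists C M, forall f, schwartz_norm N (S f) <= C * schwartz_norm M f) ->
  continuous S.
Proof.
move=> HS f A /nbhs_schwartzP[N [e e0 HA]].
have [C [M HC]] := HS N.
apply/nbhs_schwartzP; exists M, (e / (`|C| + 1)).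
  by rewrite divr_gt0// ltr_pwDr.
move=> g fg; apply: HA; rewrite -linearB (le_lt_trans (HC _))//.
apply: (@le_lt_trans _ _ ((`|C| + 1) * schwartz_norm M (f - g))).
  rewrite ler_wpM2r ?schwartz_norm_ge0//.
  by rewrite (le_trans (ler_norm _))// lerDl.
by rewrite -ltr_pdivlMl ?ltr_pwDr// mulrC.
Qed.

Section seminorm.
Variable p : schwartz R -> R.
Hypothesis pD : forall f g, p (f + g) <= p f + p g.
Hypothesis pZ : forall (c : R[i]) f, p (c *: f) <= `|c : Rcomplex R| * p f.

Lemma seminormZ (c : R[i]) f : c != 0 -> p (c *: f) = `|c : Rcomplex R| * p f.
Proof.
move=> c0; apply/eqP; rewrite eq_le pZ /=.
have := pZ c^-1 (c *: f); rewrite scalerA mulVf// scale1r Rcomplex_normV//.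
by rewrite ler_pdivlMl// normr_gt0.
Qed.

Lemma seminormN f : p (- f) = p f.
Proof.
rewrite -scaleN1r seminormZ ?oppr_eq0 ?oner_eq0// normrN.
by rewrite (Rcomplex_norm_nat 1) mul1r.
Qed.

Lemma seminormB f g : p (f - g) <= p f + p g.
Proof. by rewrite -(seminormN g); exact: pD. Qed.

Section contraction.
Variables (T : {linear schwartz R -> schwartz R}) (r : R).
Hypothesis r_ge0 : 0 <= r.
Hypothesis pT : forall f, p (T f) <= r * p f.

Lemma contraction_iter n f : p (iter n T f) <= r ^+ n * p f.
Proof.
elim: n => [|n IH]; first by rewrite mul1r.
by rewrite iterS (le_trans (pT _))// exprS -mulrA ler_wpM2l.
Qed.

(** When [r < `|l|] this a priori bound makes [T - l] injective and any inverse
    of it continuous. With [l = 1], it also bounds a sum of iterates by its two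
    extreme terms. *)
Lemma resolvent_estimate (l : R[i]) g : l != 0 ->
  (`|l : Rcomplex R| - r) * p g <= p (T g - l *: g).
Proof.
move=> l0; have := seminormB (T g) (T g - l *: g).
rewrite subKr seminormZ//; have := pT g; lra.
Qed.

End contraction.
End seminorm.
End seminorms.

Lemma resolventB (R : realType) (T : {linear schwartz R -> schwartz R})
    (l : R[i]) (f g : schwartz R) :
  T (f - g) - l *: (f - g) = (T f - l *: f) - (T g - l *: g).
Proof. by rewrite linearB scalerBr !opprD addrACA. Qed.

(** * Polynomials without fixed points *)

Section fixpoint_free.
Variables (R : realType) (phi : {poly R}) (phi1 : (1 < size phi)%N).
Hypothesis phi2 : (2 < size phi)%N.
Hypothesis nofix : forall x, phi.[x] != x.
Local Notation T := (schwartz_comp phi1).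

(** The fixed-point iteration [g |-> l^-1 *: (T g - f)] converges, its defect
    [T g - l *: g - f] being multiplied by [l^-1 *: T] at each step. *)
Lemma comp_resolvent_surjective (l : R[i]) (f : schwartz R) : l != 0 ->
  exists g : schwartz R, T g - l *: g = f.
Proof.
move=> l0; pose a := `|l : Rcomplex R|.
have a0 : 0 < a by rewrite normr_gt0.
have a20 : 0 < a / 2 by rewrite divr_gt0.
pose step g := l^-1 *: (T g - f).
pose u n := iter n step 0.
pose V n := T (u n) - l *: u n - f.
have uS n : u n.+1 - u n = l^-1 *: V n.
  rewrite /V addrAC scalerBr scalerA mulVf// scale1r.
  by [].
have VS n : V n.+1 = l^-1 *: T (V n).
  rewrite -linearZ_LR -uS linearB /V.
  have -> : l *: u n.+1 = T (u n) - f by rewrite /u iterS scalerA mulfV// scale1r.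
  by rewrite opprB addrA addrAC addrK.
have Vp p (pZ : forall (c : R[i]) h, p (c *: h) <= `|c : Rcomplex R| * p h)
    (pT : forall h, p (T h) <= a / 2 * p h) n : p (V n) <= 2^-1 ^+ n * p f.
  elim: n => [|n IH].
    by rewrite /V /u /= linear0 scaler0 subrr sub0r seminormN// mul1r.
  rewrite VS (le_trans (pZ _ _))// Rcomplex_normV// -/a.
  rewrite ler_pdivrMl// (le_trans (pT _))//.
  rewrite [leRHS](_ : _ = a / 2 * (2^-1 ^+ n * p f)) ?ler_pM2l//.
  by rewrite exprS; ring.
have cauchy N : exists K, forall n m, (n <= m)%N ->
    schwartz_norm N (u n - u m) <= K * 2^-1 ^+ n.
  have [p [C [M [[C0 pD pZ] pN _ pT]]]] := contracting_seminorm phi1 N phi2 nofix a20.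
  have p0 h : 0 <= p h by rewrite (le_trans _ (pN h))// schwartz_norm_ge0.
  exists (4 / a * p f) => n m nm; rewrite (le_trans (pN _))//.
  have := resolvent_estimate pD pZ pT (u n - u m) l0.
  have -> : T (u n - u m) - l *: (u n - u m) = V n - V m.
    by rewrite resolventB /V [in RHS]opprB subrKA.
  have h1 := Vp p pZ pT n; have h2 := Vp p pZ pT m.
  have h3 : 2^-1 ^+ m * p f <= 2^-1 ^+ n * p f.
    by rewrite ler_wpM2r// ler_wiXn2l//; lra.
  move=> /le_trans /(_ (seminormB pD pZ _ _)) h4.
  rewrite -/a in h4.
  rewrite [leRHS](_ : _ = (2^-1 ^+ n * p f + 2^-1 ^+ n * p f) / (a / 2)).
    by rewrite ler_pdivlMr// mulrC; lra.
  by field; rewrite gt_eqF.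
have [K HK] := choice cauchy.
have Kcv N : K N * 2^-1 ^+ n @[n --> \oo] --> (0 : R).
  rewrite -(mulr0 (K N)); apply: cvgMr; apply: cvg_expr.
  by rewrite ger0_norm; lra.
have [G HG] := schwartz_complete Kcv HK.
exists G; apply/eqP; rewrite -subr_eq0; apply/eqP; apply: schwartz_norm_eq0.
have [p [C [M [[C0 pD pZ] pN pM pT]]]] := contracting_seminorm phi1 0 phi2 nofix a20.
apply: (@le_of_vanishing_error _ _ _
  (fun n => 2 * a * C * (K M * 2^-1 ^+ n) + p f * 2^-1 ^+ n)).
  rewrite (_ : 0 = 2 * a * C * 0 + p f * 0); last by rewrite !mulr0 addr0.
  apply: cvgD; apply: cvgMr; first exact: Kcv.
  by apply: cvg_expr; rewrite ger0_norm; lra.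
move=> n; rewrite add0r (le_trans (pN _))//.
have -> : T G - l *: G - f = V n - (T (u n - G) - l *: (u n - G)).
  by rewrite resolventB /V [RHS]addrAC subKr.
apply: (le_trans (seminormB pD pZ _ _)); rewrite addrC.
apply: lerD; last by rewrite mulrC; exact: Vp.
apply: (le_trans (seminormB pD pZ _ _)).
have h1 := pT (u n - G).
have h2 := pZ l (u n - G); rewrite -/a in h2.
have h3 : p (u n - G) <= C * (K M * 2^-1 ^+ n).
  by rewrite (le_trans (pM _))// ler_wpM2l.
have h4 : a * p (u n - G) <= a * (C * (K M * 2^-1 ^+ n)) by rewrite ler_wpM2l// ltW.
have h5 : 0 <= a * p (u n - G).
  rewrite mulr_ge0 ?(ltW a0)// (le_trans _ (pN _))// schwartz_norm_ge0//.
lra.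
Qed.

Lemma comp_resolvent_injective (l : R[i]) (g : schwartz R) : l != 0 ->
  T g - l *: g = 0 -> g = 0.
Proof.
move=> l0 Tg; apply: schwartz_norm_eq0.
have a0 : 0 < `|l : Rcomplex R| by rewrite normr_gt0.
have a20 : 0 < `|l : Rcomplex R| / 2 by rewrite divr_gt0.
have [p [C [M [[C0 pD pZ] pN pM pT]]]] := contracting_seminorm phi1 0 phi2 nofix a20.
have := resolvent_estimate pD pZ pT g l0; rewrite Tg.
have p00 : p 0 <= 0.
  by have := pM 0; rewrite schwartz_norm0 mulr0.
move=> /le_trans /(_ p00).
rewrite (_ : `|l : Rcomplex R| - `|l : Rcomplex R| / 2 = `|l : Rcomplex R| / 2).
  rewrite pmulr_rle0// => pg; exact: le_trans (pN g) pg.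
by field.
Qed.

(** The right inverse supplied by surjectivity is linear because [T - l] is
    injective, and continuous by the resolvent estimate. *)
Lemma spectrum_fixpoint_free (l : R[i]) : spectrum T l -> l = 0.
Proof.
move=> spl; apply/eqP/negPn/negP => l0; apply: spl.
have [S HS] := choice (fun f => comp_resolvent_surjective f l0).
have SK g : S (T g - l *: g) = g.
  apply/eqP; rewrite -subr_eq0; apply/eqP.
  by apply: (comp_resolvent_injective l0); rewrite resolventB HS subrr.
have Slin : linear S.
  move=> c f g; rewrite -[RHS]SK; congr S.
  rewrite linearP scalerDr opprD addrACA HS.
  by rewrite (scalerA l c) (mulrC l c) -scalerA -scalerBr HS.
pose S' : {linear schwartz R -> schwartz R} :=
  HB.pack S (GRing.isLinear.Build _ _ _ _ _ Slin).
exists S'; split => //.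
apply: schwartz_linear_continuous => N.
have a0 : 0 < `|l : Rcomplex R| by rewrite normr_gt0.
have a20 : 0 < `|l : Rcomplex R| / 2 by rewrite divr_gt0.
have [p [C [M [[C0 pD pZ] pN pM pT]]]] := contracting_seminorm phi1 N phi2 nofix a20.
exists (C / (`|l : Rcomplex R| / 2)), M => f.
rewrite (le_trans (pN _))// mulrAC ler_pdivlMr// mulrC.
have := resolvent_estimate pD pZ pT (S f) l0; rewrite HS.
rewrite (_ : `|l : Rcomplex R| - `|l : Rcomplex R| / 2 = `|l : Rcomplex R| / 2).
  by move=> /le_trans; apply.
by field.
Qed.

(** The sum [y] of the first iterates satisfies [T y - y = T^(n+1) f - T f], so
    the resolvent estimate at [1] bounds it independently of [n], and the means
    tend to [0]. *)
Lemma mean_ergodic_fixpoint_free : mean_ergodic T.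
Proof.
have P_lin : linear (fun _ : schwartz R => 0 : schwartz R).
  by move=> c f g; rewrite scaler0 addr0.
pose P : {linear schwartz R -> schwartz R} :=
  HB.pack (fun _ : schwartz R => 0 : schwartz R)
    (GRing.isLinear.Build _ _ _ _ _ P_lin).
exists P; split.
  apply: schwartz_linear_continuous => N; exists 0, 0%N => f.
  by rewrite (_ : P f = 0)// schwartz_norm0 mul0r.
move=> f A /nbhs_schwartzP[N [e e0 HA]].
have h0 : 0 < 2^-1 :> R by lra.
have [p [C [M [[C0 pD pZ] pN pM pT]]]] := contracting_seminorm phi1 N phi2 nofix h0.
have p0 h : 0 <= p h by rewrite (le_trans _ (pN h))// schwartz_norm_ge0.
pose y n := \sum_(1 <= k < n.+1) iter k T f.
have yp n : p (y n) <= 4 * p f.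
  have l0 : (1 : R[i]) != 0 by exact: oner_neq0.
  have := resolvent_estimate pD pZ pT (y n) l0.
  rewrite (Rcomplex_norm_nat R 1) scale1r.
  have -> : T (y n) - y n = iter n.+1 T f - T f.
    rewrite /y linear_sum -sumrB.
    by under eq_bigr do rewrite -iterS; rewrite telescope_sumr.
  have h1 := seminormB pD pZ (iter n.+1 T f) (T f).
  have h2 := contraction_iter (ltW h0) pT n.+1 f.
  have h3 := pT f.
  have h4 : 2^-1 ^+ n.+1 * p f <= 1 * p f.
    by rewrite ler_wpM2r// exprn_ile1//; lra.
  have := p0 f; lra.
pose n0 := (Num.truncn (4 * p f / e)).+1.
exists n0 => // n /= n0n; apply: HA.
have nlt : 4 * p f / e < n%:R.
  by rewrite (lt_le_trans (truncnS_gt _))// ler_nat.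
have n_gt0 : (0 < n)%N by rewrite (leq_trans _ n0n).
rewrite sub0r schwartz_normN (le_lt_trans (pN _))//.
rewrite /cesaro_mean (le_lt_trans (pZ _ _))//.
rewrite Rcomplex_normV ?pnatr_eq0 -?lt0n// Rcomplex_norm_nat.
rewrite ltr_pdivrMl ?ltr0n// (le_lt_trans (yp n))//.
by rewrite -ltr_pdivrMr.
Qed.

End fixpoint_free.

(** * Gaussian test functions *)

Section gaussians.
Variable R : realType.

Definition poly_gauss (q : {poly R}) (x : R) : R := q.[x] * expR (- x ^+ 2).

Lemma is_derive_poly_gauss (q : {poly R}) (x : R) :
  is_derive x 1 (poly_gauss q) (poly_gauss (q^`() - 'X *+ 2 * q) x).
Proof.
have sq : is_derive x 1 (fun y : R => - y ^+ 2) (- (2 * x)).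
  have := is_derive_poly (- 'X^2 : {poly R}) x.
  rewrite (_ : horner _ = fun y => - y ^+ 2); last first.
    by apply/funext => y; rewrite hornerN hornerXn.
  by move=> H; apply: is_derive_eq H _; rewrite derivN derivXn !hornerE/=; ring.
have ex : is_derive x 1 (fun y : R => expR (- y ^+ 2))
    (- (2 * x) * expR (- x ^+ 2)).
  by have := @is_derive1_comp R expR _ x _ _ (is_derive_expR _) sq; rewrite mulrC.
apply: is_derive_eq (is_deriveM (is_derive_poly q x) ex) _.
by rewrite /poly_gauss !hornerE /GRing.scale /=; ring.
Qed.

(** The exponential series beats every polynomial; expanding at [1 + x ^ 2]
    rather than [x ^ 2] costs only the factor [expR 1]. *)
Lemma poly_gauss_bounded (q : {poly R}) :
  exists K, forall x, `|poly_gauss q x| <= K.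
Proof.
have [B [m [B0 HB]]] := poly_growth q.
exists (B * (2 ^+ m.+1 * (m.+1)`!%:R * expR 1)) => x.
rewrite normrM [`|expR _|]ger0_norm ?expR_ge0// expRN ler_pdivrMr ?expR_gt0//.
rewrite (le_trans (HB x))// -(mulrA B) ler_wpM2l//.
rewrite -mulrA -expRD.
have y0 : 0 <= 1 + x ^+ 2 by rewrite addr_ge0// sqr_ge0.
apply: (@le_trans _ _ ((1 + `|x|) ^+ m.+1)).
  by rewrite ler_weXn2l// lerDl.
apply: (@le_trans _ _ ((2 * (1 + x ^+ 2)) ^+ m.+1)).
  rewrite lerXn2r ?nnegrE ?mulr_ge0 ?addr_ge0 ?sqr_ge0//.
  by rewrite -(real_normK (num_real x)); have := sqr_ge0 (`|x| - 1); nra.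
rewrite exprMn -mulrA ler_wpM2l ?exprn_ge0//.
rewrite -ler_pdivrMl ?ltr0n ?fact_gt0// mulrC.
by have := expR_ge1Dxn m y0; apply: le_trans; rewrite lerDr.
Qed.

Lemma poly_gauss_schwartz (q : {poly R}) :
  is_schwartz (fun x => (poly_gauss q x)%:C%C : Rcomplex R).
Proof.
apply: (@is_schwartz_coind R (fun f =>
  exists q, f = fun x => (poly_gauss q x)%:C%C));
  last by exists q.
- move=> _ [p ->]; exists (fun x => (poly_gauss (p^`() - 'X *+ 2 * p) x)%:C%C).
    by eexists.
  move=> x; apply/is_derive_ReIm; split => /=; last exact: is_derive_cst.
  exact: is_derive_poly_gauss.
- move=> _ [p ->] i; have [K HK] := poly_gauss_bounded ('X^i * p).
  exists K => x; rewrite -normrX.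
  have -> : `|(poly_gauss p x)%:C%C : Rcomplex R| = `|poly_gauss p x|.
    by rewrite [LHS]/Num.norm /= expr0n addr0 sqrtr_sqr.
  by rewrite -normrM (le_trans _ (HK x))// /poly_gauss hornerM hornerXn mulrA.
Qed.

Lemma poly_gauss_in (q : {poly R}) :
  (fun x => (poly_gauss q x)%:C%C) \in @schwartz_pred R.
Proof. by apply/asboolP; exact: poly_gauss_schwartz. Qed.

(** These test functions separate points ([q := 'X - v]) and provide a positive
    one ([q := 1]), bounded away from [0] on compact sets. *)
Definition schwartz_gauss (q : {poly R}) : schwartz R :=
  Schwartz (poly_gauss_in q).

End gaussians.

(** * Zero is in the spectrum when there is no fixed point *)

Section zero_in_spectrum.
Variables (R : realType) (phi : {poly R}).

(** A fixed-point free polynomial of degree at least two tends to infinity with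
    the same sign at both ends, hence takes some value on both sides of [0]. *)
Lemma fixpoint_free_not_injective : (2 < size phi)%N ->
  (forall x, phi.[x] != x) -> exists u v : R, u != v /\ phi.[u] = phi.[v].
Proof.
move=> phi2 nofix.
have [A A1 HA] := poly_quadratic_growth phi2.
have [s s1 sphi] := fixpoint_free_sign nofix.
pose psi := s *: phi.
have psiE x : psi.[x] = s * phi.[x] by rewrite hornerZ.
pose M := 2 * A + `|phi.[0]|.
have M0 : 0 < M by rewrite /M ltr_pwDl//; lra.
have far (x : R) : `|x| = M -> psi.[0] < psi.[x].
  move=> xM.
  have h1 : `|psi.[x]| = `|phi.[x]| by rewrite psiE normrM s1 mul1r.
  have h2 : - M < psi.[x].
    rewrite psiE (le_lt_trans _ (sphi x))//.
    by have := ler_norm (- (s * x)); rewrite normrN normrM s1 mul1r xM; lra.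
  have h3 : 2 * M < `|phi.[x]|.
    have := HA x; rewrite xM => h.
    have : 2 * A * (1 + M) <= (1 + M) ^+ 2.
      rewrite expr2 ler_wpM2r//; first by lra.
      by have := normr_ge0 phi.[0]; rewrite /M; lra.
    nra.
  have h4 : psi.[0] <= M.
    rewrite psiE (le_trans (ler_norm _))// normrM s1 mul1r /M.
    by lra.
  have : psi.[x] = `|phi.[x]|.
    rewrite -h1 ger0_norm// leNgt; apply/negP => x0.
    by move: h1; rewrite ltr0_norm//; lra.
  lra.
have rM := far M (gtr0_norm M0).
have lM : psi.[0] < psi.[- M] by apply: far; rewrite normrN gtr0_norm.
pose v := Num.min psi.[M] psi.[- M].
have v0 : psi.[0] < v by rewrite lt_min rM lM.
have vr : v <= psi.[M] by rewrite ge_min lexx.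
have vl : v <= psi.[- M] by rewrite ge_min lexx orbT.
have [|a] := @poly_ivt R (psi - v%:P) 0 M (ltW M0).
  by rewrite !hornerD !hornerN !hornerC; apply/andP; split; lra.
move=> /andP[a0 _]; rewrite /root !hornerD !hornerN !hornerC subr_eq0 => /eqP av.
have [||b] := @poly_ivt R (v%:P - psi) (- M) 0.
- by lra.
- by rewrite !hornerD !hornerN !hornerC; apply/andP; split; lra.
move=> /andP[_ b0]; rewrite /root !hornerD !hornerN !hornerC subr_eq0 => /eqP bv.
exists a, b; split.
  apply/eqP => ab; have a00 : a = 0 by lra.
  by move: v0; rewrite -av a00 ltxx.
have s0 : s != 0 by rewrite -normr_eq0 s1 oner_eq0.
by apply: (mulfI s0); rewrite -!psiE av.
Qed.

(** Functions [g \o phi] take the same value at [u] and [v], so the operator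
    is not onto. *)
Lemma not_injective_spectrum0 (phi1 : (1 < size phi)%N) (u v : R) :
  u != v -> phi.[u] = phi.[v] -> spectrum (schwartz_comp phi1) 0.
Proof.
move=> uv phiuv [S [_ _ SK]].
have := SK (schwartz_gauss ('X - v%:P)); rewrite /= scale0r subr0.
set g := S _ => E.
have Eu : g phi.[u] = (poly_gauss ('X - v%:P) u)%:C%C.
  by rewrite -[RHS]/(schwartz_gauss _ u) -E.
have Ev : g phi.[v] = (poly_gauss ('X - v%:P) v)%:C%C.
  by rewrite -[RHS]/(schwartz_gauss _ v) -E.
move: Eu; rewrite phiuv Ev => /complexI /eqP.
rewrite /poly_gauss !hornerE subrr mul0r eq_sym mulf_eq0 subr_eq0 (negbTE uv) /=.
by rewrite expR_eq0.
Qed.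

End zero_in_spectrum.

(** * Polynomials with a fixed point *)

Section with_fixpoint.
Variables (R : realType) (phi : {poly R}) (phi1 : (1 < size phi)%N).
Local Notation T := (schwartz_comp phi1).

(** Every function in the range of [T - 1] vanishes at a fixed point. *)
Lemma fixpoint_spectrum1 (a : R) : phi.[a] = a -> spectrum T 1.
Proof.
move=> fixa [S [_ _ SK]].
have E := SK (schwartz_gauss 1).
have : (T (S (schwartz_gauss 1)) - 1 *: S (schwartz_gauss 1)) a = schwartz_gauss 1 a.
  by rewrite E.
rewrite scale1r -[LHS]/(S (schwartz_gauss 1) phi.[a] - S (schwartz_gauss 1) a).
rewrite fixa subrr => /eqP; rewrite eq_sym -[X in _ == X]/((0 : R)%:C%C).
move=> /eqP /complexI /eqP.
by rewrite /poly_gauss hornerC mul1r expR_eq0.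
Qed.

Lemma iter_comp n (f : schwartz R) (x : R) :
  iter n T f x = f (iter n (horner phi) x).
Proof. by elim: n f x => [//|n IH] f x; rewrite iterSr IH iterS. Qed.

(** The means [f_n] satisfy
    [f_n (phi x) - f_n x = (f (phi^(n+1) x) - f (phi x)) / n], and [f] is
    bounded. *)
Lemma cesaro_comp_limit_invariant (f G : schwartz R) :
  cesaro_mean T n f @[n --> \oo] --> G -> forall x, G phi.[x] = G x.
Proof.
move=> cv x; apply/eqP; rewrite -subr_eq0; apply/eqP/Rcomplex_norm_le0.
have [K HK] := is_schwartz_bounded 0 (schwartzP f).
apply/ler_addgt0Pr => e e0; rewrite add0r.
have e30 : 0 < e / 3 by rewrite divr_gt0.
have [n0 Hn] := schwartz_cvg_pointwise cv e30.
pose n := maxn n0 (Num.truncn (2 * K / (e / 3))).+1.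
have n0n : (n0 <= n)%N by rewrite leq_maxl.
have n_gt0 : (0 < n)%N by rewrite (leq_trans _ (leq_maxr _ _)).
have nK : 2 * K / (e / 3) < n%:R.
  by rewrite (lt_le_trans (truncnS_gt _))// ler_nat leq_maxr.
have h1 := Hn n phi.[x] n0n.
have h2 := Hn n x n0n.
set C1 := cesaro_mean T n f phi.[x] in h1.
set C2 := cesaro_mean T n f x in h2.
have h3 : `|(C1 - C2 : Rcomplex R)| <= e / 3.
  have -> : C1 - C2 = n%:R^-1 * (iter n.+1 T f x - iter 1 T f x).
    rewrite /C1 /C2 /cesaro_mean !schwartzZE -mulrBr !schwartz_sumE; congr (_ * _).
    rewrite -sumrB.
    transitivity (\sum_(1 <= k < n.+1) (iter k.+1 T f x - iter k T f x)).
      by apply: eq_bigr.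
    by rewrite (telescope_sumr (fun k => iter k T f x)).
  rewrite Rcomplex_normM Rcomplex_normV ?pnatr_eq0 -?lt0n// Rcomplex_norm_nat.
  rewrite ler_pdivrMl ?ltr0n//.
  apply: (le_trans (ler_normB _ _)).
  have b k : `|(iter k T f x : Rcomplex R)| <= K.
    by rewrite iter_comp; have := HK (iter k (horner phi) x); rewrite expr0 mul1r.
  apply: (le_trans (lerD (b _) (b _))).
  by move: nK; rewrite ltr_pdivrMr// => /ltW; lra.
have -> : G phi.[x] - G x = (G phi.[x] - C1) + (C1 - C2) - (G x - C2).
  by rewrite subrKA opprB subrKA.
apply: (le_trans (ler_normB _ _)).
have h4 := ler_normD (G phi.[x] - C1 : Rcomplex R) (C1 - C2 : Rcomplex R).
lra.
Qed.

Section bounded_orbits.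
Variable A : R.
Hypothesis A1 : 1 <= A.
Hypothesis HA : forall x : R, (1 + `|x|) ^+ 2 <= A * (1 + `|phi.[x]|).

Definition bounded_orbit (x : R) :=
  forall n, 1 + `|iter n (horner phi) x| <= 2 * A.

Lemma escape_doubles (y : R) n : 2 * A <= 1 + `|y| ->
  2 ^+ n * (1 + `|y|) <= 1 + `|iter n (horner phi) y|.
Proof.
elim: n y => [|n IH] y hy; first by rewrite mul1r.
have h : 2 * (1 + `|y|) <= 1 + `|phi.[y]|.
  have := HA y; rewrite expr2 => h.
  have : 2 * A * (1 + `|y|) <= (1 + `|y|) * (1 + `|y|).
    by rewrite ler_wpM2r// addr_ge0.
  move=> /le_trans /(_ h); by rewrite -mulrA mulrCA ler_pM2l ?(lt_le_trans ltr01).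
rewrite iterSr exprSr -mulrA.
have hy' : 2 * A <= 1 + `|phi.[y]| by have := normr_ge0 y; lra.
apply: le_trans (IH _ hy').
by rewrite ler_wpM2l// exprn_ge0.
Qed.

(** The value [G x] is also the value of [G] at points of the orbit that are
    arbitrarily far away, where [G] is small. *)
Lemma invariant_vanishes (G : schwartz R) (x : R) :
  (forall y, G phi.[y] = G y) -> ~ bounded_orbit x -> G x = 0.
Proof.
move=> Ginv /existsNP[n /negP]; rewrite -ltNge => esc.
set y := iter n _ x in esc.
have Giter k z : G (iter k (horner phi) z) = G z.
  by elim: k => [//|k IH]; rewrite iterS Ginv.
rewrite -(Giter n) -/y.
have [K HK] := is_schwartz_bounded 1 (schwartzP G).
have [K' HK'] := is_schwartz_bounded 0 (schwartzP G).
apply: Rcomplex_norm_le0.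
apply: (@le_of_vanishing_error _ _ _ (fun k => (K + K') * 2^-1 ^+ k)).
  rewrite -(mulr0 (K + K')); apply: cvgMr; apply: cvg_expr.
  by rewrite ger0_norm; lra.
move=> k; rewrite add0r exprVn ler_pdivlMr ?exprn_gt0//.
have := HK (iter k (horner phi) y); have := HK' (iter k (horner phi) y).
rewrite expr0 mul1r expr1 Giter => h1 h2.
have h3 := escape_doubles k (ltW esc).
have h4 : 2 ^+ k <= 1 + `|iter k (horner phi) y|.
  by apply: le_trans h3; rewrite ler_peMr ?exprn_ge0// lerDl.
have h5 : `|(G y : Rcomplex R)| * 2 ^+ k
    <= `|(G y : Rcomplex R)| * (1 + `|iter k (horner phi) y|) by rewrite ler_wpM2l.
lra.
Qed.

(** [bounded_orbit] is closed because an orbit which leaves the disc does so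
    after finitely many steps, together with the orbits of nearby points. *)
Lemma largest_bounded_orbit (a : R) : bounded_orbit a ->
  exists b, bounded_orbit b /\ forall x, b < x -> ~ bounded_orbit x.
Proof.
move=> Ka; have ubK : has_ubound bounded_orbit.
  exists (2 * A) => x /(_ 0%N) /=; have := ler_norm x; lra.
have sK : has_sup bounded_orbit by split; first by exists a.
exists (sup bounded_orbit); split; last first.
  by move=> x bx Kx; move: bx; apply/negP; rewrite -leNgt; exact: ub_le_sup.
move=> n; rewrite leNgt; apply/negP => esc.
set b := sup _ in esc.
have itc m : continuous (iter m (horner phi)).
  elim: m => [|m IH] x; first exact: cvg_id.
  apply: (@continuous_comp _ _ _ (iter m (horner phi)) (horner phi) x (IH x)).
  exact: continuous_horner.
have gap : 0 < 1 + `|iter n (horner phi) b| - 2 * A by rewrite subr_gt0.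
have /cvgrPdist_lt/(_ _ gap)/nbhs_ballP[d /= d0 Hd] := itc n b.
have [x Kx xb] := sup_adherent d0 sK.
have xle : x <= b by exact: ub_le_sup.
have bx : ball b d x by rewrite -ball_normE /= ger0_norm; rewrite -/b in xb; lra.
have := Hd x bx.
have := Kx n.
have := ler_normD (iter n (horner phi) b - iter n (horner phi) x) (iter n (horner phi) x).
rewrite subrK; lra.
Qed.

End bounded_orbits.

(** If the Cesaro means of the Gaussian converged, the limit would be invariant
    under [phi], hence zero at the points whose orbit escapes to infinity, and
    in particular to the right of the last point [b] with bounded orbit. At [b]
    the means are bounded below by the minimum of the Gaussian on the disc that
    contains the orbit, against continuity. *)
Lemma fixpoint_not_mean_ergodic (a : R) : (2 < size phi)%N -> phi.[a] = a ->
  ~ mean_ergodic T.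
Proof.
move=> phi2 fixa [P [_ Pcv]].
have [A A1 HA] := poly_quadratic_growth phi2.
have Ka : bounded_orbit A a.
  have ita n : iter n (horner phi) a = a by elim: n => [//|n IH]; rewrite iterS IH.
  move=> n; rewrite ita.
  have := HA a; rewrite fixa expr2 ler_pM2r ?ltr_pwDl//.
  lra.
have [b [Kb escb]] := largest_bounded_orbit Ka.
pose f := schwartz_gauss (1 : {poly R}).
pose G := P f.
have Ginv := cesaro_comp_limit_invariant (Pcv f).
have G0 x : b < x -> G x = 0.
  by move=> bx; apply: (invariant_vanishes A1 HA Ginv); exact: escb.
pose c := expR (- (2 * A) ^+ 2).
have c0 : 0 < c by exact: expR_gt0.
have Gb : G b = 0.
  have Gc : {for b, continuous (fun x => G x : Rcomplex R)}.
    apply: differentiable_continuous; apply/derivable1_diffP.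
    exact: is_schwartz_derivable (schwartzP G).
  apply: Rcomplex_norm_le0; apply/ler_addgt0Pr => e e0; rewrite add0r.
  have /cvgrPdist_lt/(_ _ e0)/nbhs_ballP[d /= d0 Hd] := Gc.
  have Gd : G (b + d / 2) = (0 : Rcomplex R) by apply: G0; rewrite ltrDl divr_gt0.
  rewrite -(subr0 (G b : Rcomplex R)) -Gd; apply/ltW/Hd.
  rewrite -ball_normE /= opprD addNKr normrN gtr0_norm ?divr_gt0//; lra.
have [n0 Hn] := schwartz_cvg_pointwise (Pcv f) c0.
have := Hn n0.+1 b (leqnSn _); rewrite -/G Gb sub0r normrN.
apply/negP; rewrite -leNgt.
apply: le_trans (Rcomplex_Re_le _).
rewrite /cesaro_mean schwartzZE schwartz_sumE.
pose gb k := poly_gauss 1 (iter k (horner phi) b).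
have -> : n0.+1%:R^-1 * (\sum_(1 <= k < n0.+2) iter k T f b) =
    (n0.+1%:R^-1 * \sum_(1 <= k < n0.+2) gb k)%:C%C.
  rewrite rmorphM fmorphV rmorph_nat rmorph_sum; congr (_ * _).
  by apply: eq_bigr => k _; rewrite iter_comp.
rewrite /= (le_trans _ (ler_norm _))// ler_pdivlMl ?ltr0n//.
rewrite (_ : n0.+1%:R * c = \sum_(1 <= k < n0.+2) c); last first.
  by rewrite sumr_const_nat subn1 mulr_natl.
apply: ler_sum => k _; rewrite /gb /poly_gauss hornerC mul1r ler_expR lerN2.
rewrite -(real_normK (num_real (iter _ _ _))) lerXn2r ?nnegrE ?mulr_ge0//; first by lra.
by have := Kb k; lra.
Qed.

End with_fixpoint.

(* [2 < size phi] says that the degree [(size phi).-1] is greater than one. *)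
Theorem corollary2p9 (R : realType) (phi : {poly R})
    (phi2 : (2 < size phi)%N) :
  mean_ergodic (schwartz_comp (ltnW phi2)) <->
  spectrum (schwartz_comp (ltnW phi2)) = [set 0].
Proof.
have [[a fixa]|/forallNP nofix] := pselect (exists a, phi.[a] = a).
  split; first by move=> /(fixpoint_not_mean_ergodic phi2 fixa).
  move=> spE; have := @fixpoint_spectrum1 _ _ (ltnW phi2) _ fixa.
  by rewrite spE => /eqP; rewrite oner_eq0.
have {}nofix x : phi.[x] != x by apply/eqP; exact: nofix.
split=> _; last exact: mean_ergodic_fixpoint_free.
apply/seteqP; split=> [l|_ ->]; first exact: spectrum_fixpoint_free.
have [u [v [uv phiuv]]] := fixpoint_free_not_injective phi2 nofix.
exact: not_injective_spectrum0 uv phiuv.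
Qed.
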